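(* Let $L$ be a rational polytope in $\mathbb{R}^m$ that is lattice-free in its affine hull $A$, and assume $\dim(A)\ge1$ and $A$ contains integer points. Then there exists a rational polytope $L'$ with $L\subseteq L'\subseteq A$, lattice-free in its affine hull, such that $L$ has the 2-hyperplane property if and only if $L'$ does, and such that for each facet $F$ of $L'$: (i) the affine hull of $F$ contains integer points; (ii) the split $(\pi^A(F),\pi^A_0(F))$ is $L'$-intersecting.
   Context: A convex set is lattice-free in its affine hull if its relative interior contains no integer point. Since $A$ is the affine hull of a rational polytope and contains integer points, it is a lattice subspace (spanned by its integer points). A split in $\mathbb{R}^m$ is $(\pi,\pi_0)$, $\pi\in\mathbb{Z}^m$, $\pi_0\in\mathbb{Z}$, with boundary hyperplanes $\{\pi x=\pi_0\}$ and $\{\pi x=\pi_0+1\}$; a split within $A$ is a pair of parallel rational hyperplanes of $A$ (codimension one in $A$), each containing integer points, with no integer point of $A$ strictly between them. Facets and faces of $L'$ are taken relative to $A$. For a facet $F$ of $L'$, $(\pi^A(F),\pi^A_0(F))$ is the split within $A$ whose boundary hyperplanes $H^1,H^2$ (in $A$) are parallel to $F$, with $F$ between $H^1$ and $H^2$ (possibly on $H^1$) and some points of $L'$ strictly between $F$ and $H^2$. A split is $L'$-intersecting if both its boundary hyperplanes meet $L'$. A set of points is 2-partitionable if it has at most one element or it can be partitioned into two nonempty sets lying respectively on the two boundary hyperplanes of some split. For a polytope $K$ lattice-free in its affine hull, $K_I$ is the convex hull of the integer points of $K$, and $K$ has the 2-hyperplane property if every face of $K_I$ not contained in a facet of $K$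 has a 2-partitionable set of integer points. *)

(* Defs.v *)
From HB Require Import structures.
From mathcomp Require Import all_boot all_order all_algebra.
From mathcomp Require Import reals.
Set Implicit Arguments. Unset Strict Implicit. Unset Printing Implicit Defensive.
Import Order.TTheory GRing.Theory Num.Theory.
Local Open Scope ring_scope.

Section Defs.
Variables (R : realType) (m : nat).

Definition point := 'rV[R]_m.
Definition pset := point -> Prop.

Definition dot (a x : point) : R := \sum_(i < m) a 0 i * x 0 i.
Definition idot (a : 'rV[int]_m) (x : point) : R := dot (map_mx intr a) x.

Definition is_int_pt (x : point) : Prop := exists z : 'rV[int]_m, x = map_mx intr z.
Definition is_rat_pt (x : point) : Prop := exists q : 'rV[rat]_m, x = map_mx ratr q.

Definition conv (K : pset) : pset := fun x =>
  exists (n : nat) (p : 'I_n -> point) (w : 'I_n -> R),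
    (forall i, K (p i)) /\ (forall i, 0 <= w i) /\ \sum_(i < n) w i = 1 /\
    x = \sum_(i < n) w i *: p i.

Definition aff (K : pset) : pset := fun x =>
  exists (n : nat) (p : 'I_n -> point) (w : 'I_n -> R),
    (forall i, K (p i)) /\ \sum_(i < n) w i = 1 /\
    x = \sum_(i < n) w i *: p i.

Definition rat_polytope (K : pset) : Prop :=
  exists (n : nat) (q : 'I_n -> point),
    (forall i, is_rat_pt (q i)) /\
    (forall x, K x <-> conv (fun y => exists i, y = q i) x).

Definition relint (K : pset) : pset := fun x =>
  K x /\ exists e : R, 0 < e /\
    forall y, aff K y -> (forall i, `|y 0 i - x 0 i| < e) -> K y.

Definition lattice_free (K : pset) : Prop :=
  forall z, is_int_pt z -> ~ relint K z.

(* faces (possibly empty, possibly K itself) *)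
Definition face (K G : pset) : Prop :=
  exists (a : point) (b : R), (forall x, K x -> dot a x <= b) /\
    (forall x, G x <-> (K x /\ dot a x = b)).

Definition diff_mx (n : nat) (p0 : point) (p : 'I_n -> point) : 'M[R]_(n, m) :=
  \matrix_(i < n, j < m) (p i - p0) 0 j.

Definition affdim_ge (S : pset) (k : nat) : Prop :=
  exists (n : nat) (p0 : point) (p : 'I_n -> point),
    S p0 /\ (forall i, S (p i)) /\
    (k <= \rank (diff_mx p0 p))%N.

Definition affdim (S : pset) (d : nat) : Prop :=
  affdim_ge S d /\ ~ affdim_ge S d.+1.

Definition facet (K F : pset) : Prop :=
  face K F /\ exists d : nat, affdim K d.+1 /\ affdim F d.

Definition int_hull (K : pset) : pset := conv (fun x => K x /\ is_int_pt x).

Definition two_partitionable (P : pset) : Prop :=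
  (forall x y, P x -> P y -> x = y) \/
  exists (pi : 'rV[int]_m) (pi0 : int) (P1 P2 : pset),
    (forall x, P x <-> (P1 x \/ P2 x)) /\ (forall x, P1 x -> ~ P2 x) /\
    (exists x, P1 x) /\ (exists x, P2 x) /\
    (forall x, P1 x -> idot pi x = pi0%:~R) /\
    (forall x, P2 x -> idot pi x = (pi0 + 1)%:~R).

Definition two_hyperplane_property (K : pset) : Prop :=
  forall G, face (int_hull K) G ->
    ~ (exists F, facet K F /\ forall x, G x -> F x) ->
    two_partitionable (fun x => G x /\ is_int_pt x).

Definition between (u v w : R) : Prop := (u <= v <= w) \/ (w <= v <= u).
Definition sbetween (u v w : R) : Prop := (u < v < w) \/ (w < v < u).

(* split within the affine subspace A: boundary hyperplanes
   H1 = A ∩ {a.x = b1}, H2 = A ∩ {a.x = b2}, a rational normal *)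
Definition split_within (A : pset) (a : point) (b1 b2 : R) : Prop :=
  is_rat_pt a /\
  (exists x y, A x /\ A y /\ dot a x <> dot a y) /\
  b1 <> b2 /\
  (exists z, A z /\ is_int_pt z /\ dot a z = b1) /\
  (exists z, A z /\ is_int_pt z /\ dot a z = b2) /\
  (forall z, A z -> is_int_pt z -> ~ sbetween b1 (dot a z) b2).

(* (a, b1, b2) represents the split (pi^A(F), pi^A_0(F)) of the facet F of K *)
Definition facet_split (A K F : pset) (a : point) (b1 b2 : R) : Prop :=
  split_within A a b1 b2 /\
  exists c : R, (forall x, F x -> dot a x = c) /\ between b1 c b2 /\
    exists y, K y /\ sbetween c (dot a y) b2.

Definition split_intersecting (K : pset) (a : point) (b1 b2 : R) : Prop :=
  (exists x, K x /\ dot a x = b1) /\ (exists x, K x /\ dot a x = b2).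

End Defs.

(* Main.v *)
(** Write A for the affine hull of L; integer coordinates adapted to A come from the
    Smith normal form.

    If L lies between the two hyperplanes of a split of A, then every face of the
    integer hull that is in no facet meets both hyperplanes, so L has the 2-hyperplane
    property, and so does the slab of that split cut off by a large integral box; take
    that for L'.

    Otherwise describe L by integral inequalities. An inequality [a x <= b] whose
    hyperplane contains no integer point of A is replaced by [(M a + c) x <= M b + T],
    where c is a coordinate form, T bounds c on a large integral box and M is large and
    chosen so that the new form takes every integer value on the lattice of A. Inside
    the box no integer point is gained or lost, so the integer hull and the integer
    points on facets are unchanged. If the split of a facet of L' were not
    intersecting, L' and hence L would lie in a split of A. *)

Require Import Defs.
From HB Require Import structures.
From mathcomp Require Import all_boot all_order all_algebra.
From mathcomp Require Import boolp reals.
From mathcomp Require Import zify ring lra.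
Set Implicit Arguments. Unset Strict Implicit. Unset Printing Implicit Defensive.
Import Order.TTheory GRing.Theory Num.Theory.
Local Open Scope ring_scope.

(** The obstacle is that [L'] has to grow while keeping its integer points. Moving a hyperplane that
    misses the lattice outwards to the next lattice level could let new integer points in, so it is
    tilted instead: the new hyperplane does contain integer points of [A], but all of them lie
    outside the box. The tilt needs a second lattice coordinate. A line has none, but there a
    lattice-free segment lies in a split, so this case never reaches the tilt. A facet of [L'] lies
    on the first hyperplane of its split because its affine hull contains an integer point. If [L']
    missed the second hyperplane, convexity would confine it to a half-open slab. When [L] lies in
    no split this is impossible since [L'] contains [L]; in the slab case it is impossible since
    [L'] contains integer points that affinely span [A], and they would all lie on one hyperplane.
    Polytopes are given by rational points while the argument runs on integral inequalities, so both
    passages are needed: Fourier-Motzkin elimination in one direction, successive cuts of an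
    integral cross-polytope in the other. *)

(** * Linear functionals, convex hulls and affine hulls *)

Section Dot.
Variables (R : realType) (m : nat).
Implicit Types (a x y p q : point R m) (al z : 'rV[int]_m).

Lemma dotDr a x y : dot a (x + y) = dot a x + dot a y.
Proof. by rewrite -big_split; apply: eq_bigr => i _; rewrite mxE mulrDr. Qed.

Lemma dotZr a (k : R) x : dot a (k *: x) = k * dot a x.
Proof. by rewrite mulr_sumr; apply: eq_bigr => i _; rewrite mxE mulrCA. Qed.

Lemma dotNr a x : dot a (- x) = - dot a x.
Proof. by rewrite -scaleN1r dotZr mulN1r. Qed.

Lemma dotBr a x y : dot a (x - y) = dot a x - dot a y.
Proof. by rewrite dotDr dotNr. Qed.

Lemma dot0r a : dot a 0 = 0.
Proof. by rewrite -(scale0r 0) dotZr mul0r. Qed.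

Lemma dot_sumr a (J : finType) (P : pred J) (w : J -> R) (p : J -> point R m) :
  dot a (\sum_(j | P j) w j *: p j) = \sum_(j | P j) w j * dot a (p j).
Proof.
elim/big_rec2: _ => [|j y1 y2 _ <-]; first by rewrite dot0r.
by rewrite dotDr dotZr.
Qed.

Lemma dot_line a x p q (s : R) :
  dot a (x + s *: (p - q)) = dot a x + s * (dot a p - dot a q).
Proof. by rewrite dotDr dotZr dotBr. Qed.

Lemma dotDl a b x : dot (a + b) x = dot a x + dot b x.
Proof. by rewrite -big_split; apply: eq_bigr => i _; rewrite mxE mulrDl. Qed.

Lemma dotZl (k : R) a x : dot (k *: a) x = k * dot a x.
Proof. by rewrite mulr_sumr; apply: eq_bigr => i _; rewrite mxE mulrA. Qed.

Lemma idotD al be x : idot (al + be) x = idot al x + idot be x.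
Proof. by rewrite /idot map_mxD dotDl. Qed.

Lemma idotZ (k : int) al x : idot (k *: al) x = k%:~R * idot al x.
Proof. by rewrite /idot map_mxZ dotZl. Qed.

Lemma idotN al x : idot (- al) x = - idot al x.
Proof. by rewrite -scaleN1r idotZ mulrNz mulr1z mulN1r. Qed.

Lemma idotB al be x : idot (al - be) x = idot al x - idot be x.
Proof. by rewrite idotD idotN. Qed.

Lemma idot0 x : idot 0 x = 0.
Proof. by rewrite -(scale0r 0) idotZ mul0r. Qed.

Definition zdot (al z : 'rV[int]_m) : int := \sum_i al 0 i * z 0 i.

Lemma idot_int al z : idot al (map_mx intr z) = (zdot al z)%:~R :> R.
Proof. by rewrite rmorph_sum; apply: eq_bigr => i _; rewrite !mxE rmorphM. Qed.

Lemma is_int_rat x : is_int_pt x -> is_rat_pt x.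
Proof.
move=> [z ->]; exists (map_mx intr z); apply/rowP => i.
by rewrite !mxE ratr_int.
Qed.

Lemma int_ptD x y : is_int_pt x -> is_int_pt y -> is_int_pt (x + y).
Proof. by move=> [u ->] [v ->]; exists (u + v); rewrite map_mxD. Qed.

Lemma int_ptZ (k : int) x : is_int_pt x -> is_int_pt (k%:~R *: x).
Proof. by move=> [u ->]; exists (k *: u); rewrite map_mxZ. Qed.

Lemma int_ptB x y : is_int_pt x -> is_int_pt y -> is_int_pt (x - y).
Proof. by move=> [u ->] [v ->]; exists (u - v); rewrite map_mxB. Qed.

Lemma rat_ptD x y : is_rat_pt x -> is_rat_pt y -> is_rat_pt (x + y).
Proof. by move=> [u ->] [v ->]; exists (u + v); rewrite map_mxD. Qed.

Lemma rat_ptZ (k : rat) x : is_rat_pt x -> is_rat_pt (ratr k *: x).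
Proof. by move=> [u ->]; exists (k *: u); rewrite map_mxZ. Qed.

Lemma idot_rat al x : is_rat_pt x -> exists k : rat, idot al x = ratr k.
Proof.
move=> [q ->]; exists (\sum_i (al 0 i)%:~R * q 0 i).
rewrite rmorph_sum; apply: eq_bigr => i _.
by rewrite !mxE rmorphM /= ratr_int.
Qed.

Lemma rat_pt_denom x : is_rat_pt x ->
  exists (D : int) (p : 'rV[int]_m), 0 < D /\ D%:~R *: x = map_mx intr p.
Proof.
move=> [q ->].
exists (\prod_i denq (q 0 i)).
exists (\row_j (numq (q 0 j) * \prod_(i | i != j) denq (q 0 i))); split.
  by apply: prodr_gt0 => i _; exact: denq_gt0.
apply/rowP => j; rewrite !mxE (bigD1 j) //= !rmorphM /= mulrAC; congr (_ * _).
rewrite -(ratr_int _ (numq (q 0 j))) -(ratr_int _ (denq (q 0 j))).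
by rewrite -rmorphM /= mulrC -numqE.
Qed.

(** Membership is asked only where the weight is nonzero, so a family may be indexed by a convenient
    finite type and take arbitrary values at weight 0. *)
Lemma conv_fin (K : pset R m) (J : finType) (p : J -> point R m) (w : J -> R) :
  (forall j, w j != 0 -> K (p j)) -> (forall j, 0 <= w j) ->
  \sum_j w j = 1 -> conv K (\sum_j w j *: p j).
Proof.
move=> Kp w0 w1; pose S := [pred j | w j != 0].
exists #|S|, (fun i => p (enum_val i)), (fun i => w (enum_val i)).
split; first by move=> i; apply: Kp; have := enum_valP i.
split=> //; split.
  rewrite -(big_enum_val (A := S) w) /= -w1 [RHS](bigID S) /=.
  by rewrite [X in _ + X]big1 ?addr0 // => j; rewrite negbK => /eqP.
rewrite -(big_enum_val (A := S) (fun j => w j *: p j)) /= (bigID S) /=.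
by rewrite [X in _ + X]big1 ?addr0 // => j; rewrite negbK => /eqP ->; rewrite scale0r.
Qed.

Lemma conv_sub (K K' : pset R m) : (forall x, K x -> K' x) ->
  forall x, conv K x -> conv K' x.
Proof.
by move=> h x [n [p [w [Kp H]]]]; exists n, p, w; split=> // i; exact: h.
Qed.

Lemma sub_conv (K : pset R m) x : K x -> conv K x.
Proof.
move=> Kx; exists 1%N, (fun _ => x), (fun _ => 1); split=> //; split=> //.
by rewrite !big_ord1 scale1r.
Qed.

Lemma conv_le (K : pset R m) a (b : R) :
  (forall x, K x -> dot a x <= b) -> forall x, conv K x -> dot a x <= b.
Proof.
move=> h x [n [p [w [Kp [w0 [w1 ->]]]]]].
rewrite dot_sumr -[b]mul1r -w1 mulr_suml.
by apply: ler_sum => i _; apply: ler_wpM2l => //; exact: h.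
Qed.

Lemma sub_aff (K : pset R m) x : K x -> aff K x.
Proof.
move=> Kx; exists 1%N, (fun _ => x), (fun _ => 1); split=> //; split=> //.
  by rewrite !big_ord1.
by rewrite !big_ord1 scale1r.
Qed.

Lemma aff_sub (K K' : pset R m) : (forall x, K x -> K' x) ->
  forall x, aff K x -> aff K' x.
Proof.
by move=> h x [n [p [w [Kp H]]]]; exists n, p, w; split=> // i; exact: h.
Qed.

Lemma aff_const (K : pset R m) a (b : R) :
  (forall x, K x -> dot a x = b) -> forall x, aff K x -> dot a x = b.
Proof.
move=> h x [n [p [w [Kp [w1 ->]]]]].
rewrite dot_sumr -[b]mul1r -w1 mulr_suml.
by apply: eq_bigr => i _; rewrite h.
Qed.

(** The three-point form allows a move from [x] along a direction of the set that is unrelated to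
    [x]. *)
Definition affine (A : pset R m) : Prop :=
  forall x p q (s : R), A x -> A p -> A q -> A (x + s *: (p - q)).

Lemma aff_affine (K : pset R m) : affine (aff K).
Proof.
move=> _ _ _ s [n [p [w [Kp [w1 ->]]]]] [n' [p' [w' [Kp' [w1' ->]]]]]
  [n'' [p'' [w'' [Kp'' [w1'' ->]]]]].
exists (n + (n' + n''))%N.
exists (fun i => match split i with inl j => p j | inr j =>
   match split j with inl k => p' k | inr k => p'' k end end).
exists (fun i => match split i with inl j => w j | inr j =>
   match split j with inl k => s * w' k | inr k => - (s * w'' k) end end).
split.
  by move=> i; case: (split i) => // j; case: (split j).
have spl k l (j : 'I_k) : split (lshift l j) = inl j by exact: (unsplitK (inl j)).
have spr k l (j : 'I_l) : split (rshift k j) = inr j by exact: (unsplitK (inr j)).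
split.
  rewrite !big_split_ord /=.
  under eq_bigr do rewrite spl.
  under [in X in _ + X]eq_bigr do rewrite spr spl.
  under [X in _ + (_ + X)]eq_bigr do rewrite spr spr.
  rewrite w1 sumrN -!mulr_sumr w1' w1''; ring.
rewrite !big_split_ord /=.
under [in RHS]eq_bigr do rewrite spl.
under [X in _ = _ + (X + _)]eq_bigr do rewrite spr spl -scalerA.
under [X in _ = _ + (_ + X)]eq_bigr do rewrite spr spr scaleNr -scalerA.
by rewrite sumrN -!scaler_sumr scalerBr.
Qed.

(** Weights of sum 1 turn the combination into [p ord0] plus multiples of differences, which are
    added one at a time. *)
Lemma affine_sum (A : pset R m) : affine A -> forall x, aff A x -> A x.
Proof.
move=> Aa x [n [p [w [Ap [w1 ->]]]]].
case: n p w Ap w1 => [|n] p w Ap w1.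
  by move: w1; rewrite big_ord0 => /eqP; rewrite eq_sym oner_eq0.
have -> : \sum_i w i *: p i = p ord0 + \sum_i w i *: (p i - p ord0).
  under [in RHS]eq_bigr do rewrite scalerBr.
  by rewrite sumrB -scaler_suml w1 scale1r addrC subrK.
apply: (big_rec (fun v => A (p ord0 + v))) => [|i v _ Av].
  by rewrite addr0; exact: Ap.
by rewrite addrCA addrC; exact: Aa.
Qed.

End Dot.

(** * Rational polytopes: from generators to inequalities, and cuts by half-spaces *)

Section Polyhedra.
Variables (R : realType) (m : nat).
Implicit Types (x y p q : point R m) (h t : R) (V : seq (point R m)).

Definition constr : Type := 'rV[int]_m * int.
Implicit Types (c : constr) (s : seq constr).

Definition sat s x : Prop := forall c, c \in s -> idot c.1 x <= c.2%:~R.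

(** Homogenisation: [h] records the total weight, so that the slice [h = 1] is the convex hull. The
    recursion exposes one multiplier at a time, ready for elimination. *)
Fixpoint cone V x h : Prop :=
  if V is q :: V' then exists t, 0 <= t /\ cone V' (x - t *: q) (h - t)
  else x = 0 /\ h = 0.

Lemma cone0 V : cone V 0 0.
Proof.
elim: V => [|q V IH] //=; exists 0; split=> //.
by rewrite scale0r !subr0.
Qed.

Lemma coneD V x y h h' : cone V x h -> cone V y h' -> cone V (x + y) (h + h').
Proof.
elim: V x y h h' => [|q V IH] x y h h' /=.
  by move=> [-> ->] [-> ->]; rewrite !addr0.
move=> [t [t0 ct]] [t' [t0' ct']]; exists (t + t'); split; first exact: addr_ge0.
by rewrite scalerDl !opprD !(addrACA _ _ (- _)); exact: IH.
Qed.

Lemma cone_gen V q t : q \in V -> 0 <= t -> cone V (t *: q) t.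
Proof.
elim: V => [|p V IH] //=; rewrite in_cons => /orP[/eqP ->|qV] t0.
  by exists t; rewrite !subrr; split=> //; exact: cone0.
by exists 0; rewrite scale0r !subr0; split=> //; exact: IH.
Qed.

Lemma coneP V x h : cone V x h ->
  exists w : 'I_(size V) -> R, (forall i, 0 <= w i) /\ \sum_i w i = h /\
    x = \sum_i w i *: V`_i.
Proof.
elim: V x h => [|q V IH] x h /=.
  by move=> [-> ->]; exists (fun _ => 0); rewrite !big_ord0; split=> // i.
move=> [t [t0 /IH [w [w0 [w1 xE]]]]].
exists (fun i => if unlift ord0 i is Some j then w j else t); split.
  by move=> i; case: (unlift _ _).
rewrite !big_ord_recl unlift_none /=.
under eq_bigr do rewrite liftK.
under [in X in _ /\ X]eq_bigr do rewrite liftK add0n /=.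
by rewrite w1 -xE; split; [rewrite addrC subrK | rewrite addrC subrK].
Qed.

Lemma conv_coneP V x : conv (fun y => y \in V) x <-> cone V x 1.
Proof.
split=> [[n [p [w [pV [w0 [<- ->]]]]]]|/coneP[w [w0 [w1 ->]]]].
  elim/big_rec2: _ => [|i y t _ ct]; first exact: cone0.
  by apply: coneD ct; exact: cone_gen.
exists (size V), (fun i => V`_i), w; split=> // i; exact: mem_nth.
Qed.

(** The value is the largest of 0 and the lower bounds [f c]. Its being attained singles out the one
    inequality to be paired with each upper bound in the elimination. *)
Lemma tight_lower_bound (T : eqType) (E : seq T) (P : pred T) (f : T -> R) :
  exists t, [/\ 0 <= t, forall c : T, c \in E -> P c -> f c <= t
    & t = 0 \/ exists2 c : T, (c \in E) && P c & t = f c].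
Proof.
elim: E => [|c E [t [t0 tE tf]]]; first by exists 0; split=> //; left.
case Pc: (P c); last first.
  exists t; split=> //.
    by move=> d; rewrite in_cons => /orP[/eqP ->|]; [rewrite Pc|exact: tE].
  case: tf => [->|[d /andP[dE Pd] ->]]; first by left.
  by right; exists d => //; rewrite in_cons dE orbT.
case: (leP (f c) t) => fct.
  exists t; split=> //.
    by move=> d; rewrite in_cons => /orP[/eqP ->|]; [|exact: tE].
  case: tf => [->|[d /andP[dE Pd] ->]]; first by left.
  by right; exists d => //; rewrite in_cons dE orbT.
exists (f c); split.
- exact: le_trans t0 (ltW fct).
- move=> d; rewrite in_cons => /orP[/eqP ->|dE Pd] //.
  exact: le_trans (tE _ dE Pd) (ltW fct).
- by right; exists c => //; rewrite in_cons eqxx Pc.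
Qed.

Definition hsat s x h : Prop := forall c, c \in s -> idot c.1 x - c.2%:~R * h <= 0.

(* Fourier-Motzkin elimination of the multiplier of the generator [q]. *)
Lemma hsat_add_ray s q : is_rat_pt q ->
  exists s', forall x h,
    (exists t, 0 <= t /\ hsat s (x - t *: q) (h - t)) <-> hsat s' x h.
Proof.
move=> /rat_pt_denom [D [p [D0 pE]]].
(* [D] times the value of the homogeneous inequality at the generator [(q, 1)]; clearing the
   denominator keeps the new system integral. Its sign decides whether [c] bounds the multiplier
   from below or from above. *)
pose g c : int := zdot c.1 p - c.2 * D.
have D0' : 0 < D%:~R :> R by rewrite ltr0z.
have gE c x h t : idot c.1 (x - t *: q) - c.2%:~R * (h - t)
   = idot c.1 x - c.2%:~R * h - t * ((g c)%:~R / D%:~R).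
  have -> : (g c)%:~R / D%:~R = idot c.1 q - c.2%:~R.
    have -> : idot c.1 q = (zdot c.1 p)%:~R / D%:~R.
      by rewrite -idot_int -pE /idot dotZr mulrC mulKf // gt_eqF.
    by rewrite /g rmorphB rmorphM /= mulrBl mulfK // gt_eqF.
  rewrite /idot dotBr dotZr -!/(idot _ _).
  by ring.
(* The combination in which the multiplier [t] cancels. *)
pose mix c c' : constr := ((g c) *: c'.1 - (g c') *: c.1, g c * c'.2 - g c' * c.2).
have mixE c c' x h : idot (mix c c').1 x - (mix c c').2%:~R * h =
   (g c)%:~R * (idot c'.1 x - c'.2%:~R * h) - (g c')%:~R * (idot c.1 x - c.2%:~R * h).
  by rewrite /= idotB !idotZ; move: (g c) (g c') => G G'; ring.
(* Inequalities with [g c <= 0] also appear by themselves: this pairs them with the lower bound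
   [0 <= t]. *)
exists ([seq c <- s | g c <= 0] ++
   [seq mix c c' | c <- [seq c <- s | 0 < g c], c' <- [seq c <- s | g c <= 0]]).
move=> x h; split=> [[t [t0 ht]] c|hs].
  rewrite mem_cat mem_filter => /orP[/andP[gc cs]|/allpairsP[[c1 c2] /= [+ + ->]]].
    have := ht _ cs; rewrite gE.
    have : t * ((g c)%:~R / D%:~R) <= 0.
      by rewrite mulr_ge0_le0 // pmulr_lle0 ?invr_gt0 // lerz0.
    by move=> *; lra.
  rewrite !mem_filter => /andP[g1 c1s] /andP[g2 c2s].
  have := ht _ c1s; have := ht _ c2s; rewrite !gE mixE.
  set F1 := idot c1.1 x - _; set F2 := idot c2.1 x - _.
  have : 0 < (g c1)%:~R :> R by rewrite ltr0z.
  have : (g c2)%:~R <= 0 :> R by rewrite lerz0.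
  move: (g c1)%:~R (g c2)%:~R => G1 G2 G20 G10.
  rewrite !subr_le0 => h2 h1.
  have k1 : G1 * F2 <= G1 * (t * (G2 / D%:~R)) by rewrite ler_pM2l.
  have k2 : G2 * (t * (G1 / D%:~R)) <= G2 * F1 by rewrite ler_wnM2l.
  have e : G2 * (t * (G1 / D%:~R)) = G1 * (t * (G2 / D%:~R)) by ring.
  by apply: le_trans k1 _; rewrite -e.
have [t [t0 tlow tf]] := tight_lower_bound s (fun c => 0 < g c)
  (fun c => (idot c.1 x - c.2%:~R * h) / (g c)%:~R * D%:~R).
exists t; split=> // c cs; rewrite gE.
case: (ltP 0 (g c)) => gc.
  have gc' : 0 < (g c)%:~R :> R by rewrite ltr0z.
  have := tlow _ cs gc; rewrite subr_le0 mulrA ler_pdivlMr //.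
  by rewrite mulrAC ler_pdivrMr.
have hc : idot c.1 x - c.2%:~R * h <= 0.
  by apply: hs; rewrite mem_cat mem_filter gc cs.
case: tf => [->|[c' /andP[c's gc'] ->]]; first by rewrite mul0r subr0.
have gc'' : 0 < (g c')%:~R :> R by rewrite ltr0z.
have := hs (mix c' c); rewrite mem_cat mixE.
have -> : mix c' c \in [seq mix c c' | c <- [seq c <- s | 0 < g c], c' <- [seq c <- s | g c <= 0]].
  by apply/allpairsP; exists (c', c); rewrite !mem_filter gc' c's gc cs.
rewrite orbT => /(_ isT).
set F1 := idot c.1 x - _; set F2 := idot c'.1 x - _ => H.
rewrite -mulrA (mulrC D%:~R) divfK ?gt_eqF // mulrAC subr_le0 ler_pdivlMr //.
by rewrite mulrC; move: H; rewrite subr_le0 (mulrC _ F2).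
Qed.

(** Induction on the generators. The empty cone is the origin, cut out by both signs of every
    coordinate and of the height. *)
Lemma cone_hrep V : (forall q, q \in V -> is_rat_pt q) ->
  exists s, forall x h, cone V x h <-> hsat s x h.
Proof.
elim: V => [_|q V IH Vr].
  pose E := [seq (delta_mx 0 i, 0) | i <- enum 'I_m] : seq constr.
  exists ((0, 1) :: (0, -1) :: E ++ [seq (- c.1, 0) | c <- E]) => x h.
  have idot_delta i : idot (delta_mx 0 i) x = x 0 i.
    rewrite /idot /dot (bigD1 i) //= !mxE !eqxx mul1r big1 ?addr0 // => j ji.
    by rewrite !mxE (negPf ji) andbF mul0r.
  split=> [[-> ->] c _|H]; first by rewrite /idot dot0r mulr0 subr0.
  split.
    apply/rowP => i; rewrite mxE; apply/le_anti.
    have iE : (delta_mx 0 i, 0) \in E by apply: map_f; rewrite mem_enum.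
    have := H (delta_mx 0 i, 0); have := H (- delta_mx 0 i, 0).
    rewrite !in_cons !mem_cat iE (map_f (fun c : constr => (- c.1, 0)) iE) !orbT.
    move=> /(_ isT) + /(_ isT); rewrite /= idotN idot_delta; lra.
  have := H (0, 1); have := H (0, -1); rewrite !in_cons !eqxx !orbT.
  by move=> /(_ isT) + /(_ isT); rewrite /= idot0; lra.
have [s sE] := IH (fun p pV => Vr p (@mem_behead _ (q :: V) p pV)).
have [s' s'E] := hsat_add_ray s (Vr q (mem_head _ _)).
exists s' => x h; rewrite -s'E /=.
by split=> -[t [t0 /sE ct]]; exists t.
Qed.

Lemma rat_polytopeP (K : pset R m) : rat_polytope K <->
  exists V, (forall q, q \in V -> is_rat_pt q) /\
    (forall x, K x <-> conv (fun y => y \in V) x).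
Proof.
split=> [[n [q [qr KE]]]|[V [Vr KE]]].
  exists (codom q); split=> [_ /codomP[i ->] //|x]; rewrite KE.
  by split; apply: conv_sub => y; [move=> [i ->]; exact: codom_f|move=> /codomP].
exists (size V), (fun i => V`_i); split=> [i|x].
  by apply: Vr; exact: mem_nth.
rewrite KE; split; apply: conv_sub => y.
  by move=> /(nthP 0) [i iV <-]; exists (Ordinal iV).
by move=> [i ->]; exact: mem_nth.
Qed.

Lemma rat_polytope_hrep (K : pset R m) : rat_polytope K ->
  exists s, forall x, K x <-> sat s x.
Proof.
move=> /rat_polytopeP [V [Vr KE]]; have [s sE] := cone_hrep Vr.
exists s => x; rewrite KE conv_coneP sE.
by split=> H c /H; rewrite mulr1 subr_le0.
Qed.

(* The mass above the hyperplane is transported onto the mass below it,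
   proportionally to the distances. *)
Lemma rat_polytope_cut (K : pset R m) c : rat_polytope K ->
  rat_polytope (fun x => K x /\ idot c.1 x <= c.2%:~R).
Proof.
move=> /rat_polytopeP [V [Vr KE]]; apply/rat_polytopeP.
pose f x := idot c.1 x - c.2%:~R.
(* The point where the segment from [p] to [q] crosses the hyperplane. *)
pose mix p q := (- f q / (f p - f q)) *: p + (f p / (f p - f q)) *: q.
have fmix p q : 0 < f p -> f q <= 0 -> f (mix p q) = 0.
  move=> fp fq; rewrite /f /mix /idot dotDr !dotZr -/(idot _ p) -/(idot _ q).
  have -> : idot c.1 p = f p + c.2%:~R by rewrite /f; ring.
  have -> : idot c.1 q = f q + c.2%:~R by rewrite /f; ring.
  by field; lra.
exists ([seq q <- V | f q <= 0] ++
  [seq mix p q | p <- [seq p <- V | 0 < f p], q <- [seq q <- V | f q <= 0]]).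
split.
  move=> q; rewrite mem_cat mem_filter.
  case/orP => [/andP[_ /Vr]|/allpairsP[[p1 p2] /= [+ + ->]]] //.
  rewrite !mem_filter => /andP[_ /Vr r1] /andP[_ /Vr r2].
  have [k1 e1] := idot_rat c.1 r1; have [k2 e2] := idot_rat c.1 r2.
  have fr k x : idot c.1 x = ratr k -> f x = ratr (k - c.2%:~R).
    by move=> e; rewrite /f e rmorphB /= ratr_int.
  rewrite /mix (fr _ _ e1) (fr _ _ e2) -rmorphB /= -!rmorphN -!fmorph_div /=.
  by apply: rat_ptD; apply: rat_ptZ.
move=> x; split=> [[/KE [n [p [w [pV [w0 [w1 xE]]]]]] fx]|Hx]; last first.
  split; last first.
    apply: conv_le Hx => y; rewrite mem_cat mem_filter.
    case/orP => [/andP[]|/allpairsP[[p q] /= [+ + ->]]].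
      by rewrite /f subr_le0.
    rewrite !mem_filter => /andP[fp _] /andP[fq _].
    by rewrite -subr_le0 -/(idot _ _) -/(f _) fmix.
  apply/KE; have convV y z t t' : y \in V -> z \in V -> 0 <= t -> 0 <= t' ->
     t + t' = 1 -> conv (fun y => y \in V) (t *: y + t' *: z).
    move=> yV zV t0 t0' tt; apply/conv_coneP; rewrite -tt.
    by apply: coneD; apply: cone_gen.
  case: Hx => n [p [w [pV [w0 [w1 ->]]]]]; apply/conv_coneP; rewrite -w1.
  have cp i : cone V (p i) 1.
    have := pV i; rewrite mem_cat mem_filter.
    case/orP => [/andP[_ qV]|/allpairsP[[q q'] /= [+ + ->]]].
      by rewrite -[p i]scale1r; exact: cone_gen.
    rewrite !mem_filter => /andP[fp qV] /andP[fq qV'].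
    apply/conv_coneP; apply: convV => //.
    - by rewrite divr_ge0 //; lra.
    - by rewrite divr_ge0 //; lra.
    - by field; lra.
  have coneZ t y h : 0 <= t -> cone V y h -> cone V (t *: y) (t * h).
    move=> t0; elim: (V) y h => [|q W IH] y h /=.
      by move=> [-> ->]; rewrite scaler0 mulr0.
    move=> [r [r0 /IH H]]; exists (t * r); split; first exact: mulr_ge0.
    by rewrite -scalerA -scalerBr -mulrBr.
  elim/big_rec2: _ => [|i y t _ ct]; first exact: cone0.
  by apply: coneD ct; rewrite -[X in cone _ _ X]mulr1; exact: coneZ.
pose u i := f (p i).
have fxE : \sum_i w i * u i <= 0.
  rewrite /u /f; under eq_bigr do rewrite mulrBr.
  by rewrite sumrB -mulr_suml w1 mul1r subr_le0 /idot -dot_sumr -xE.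
pose Sp := \sum_(i | 0 < u i) w i * u i.
pose Sm := \sum_(i | ~~ (0 < u i)) w i * - u i.
have SpSm : Sp <= Sm.
  move: fxE; rewrite (bigID (fun i => 0 < u i)) /= -/Sp.
  by under [X in _ + X]eq_bigr do rewrite -[u _]opprK mulrN; rewrite sumrN subr_le0.
have Sp0 : 0 <= Sp by apply: sumr_ge0 => i ui; rewrite mulr_ge0 // ltW.
(* Mass above goes to the crossing points, and a point below keeps the fraction [1 - Sp / Sm] of its
   weight. If [Sm = 0] then [Sp = 0] too, points above have weight 0, and nothing moves. *)
pose W (k : 'I_n + 'I_n * 'I_n) : R := match k with
  | inl j => if 0 < u j then if Sm == 0 then w j else 0 else w j * (1 - Sp / Sm)
  | inr (i, j) => if (0 < u i) && ~~ (0 < u j)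
     then w i * w j / Sm * (u i - u j) else 0 end.
pose Q (k : 'I_n + 'I_n * 'I_n) : point R m := match k with
  | inl j => p j | inr (i, j) => mix (p i) (p j) end.
have Sm0 : 0 <= Sm by exact: le_trans SpSm.
have wz i : Sm = 0 -> 0 < u i -> w i = 0.
  move=> Sm00 ui; have : Sp = 0 by apply/le_anti; rewrite Sp0 -Sm00 SpSm.
  move/psumr_eq0P => /(_ _ i ui) H; apply/eqP.
  have /eqP : w i * u i = 0 by apply: H => j uj; rewrite mulr_ge0 // ltW.
  by rewrite mulf_eq0 (gt_eqF ui) orbF.
have W0 k : 0 <= W k.
  case: k => [j|[i j]] /=.
    case: ifP => uj; first by case: ifP.
    rewrite mulr_ge0 // subr_ge0; case: (eqVneq Sm 0) => [->|Smn].
      by rewrite invr0 mulr0.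
    by rewrite ler_pdivrMr ?mul1r // lt_def Smn.
  case: ifP => // /andP[ui]; rewrite -leNgt => uj.
  by rewrite !mulr_ge0 ?invr_ge0 //; lra.
have sumW (M : lmodType R) (F : 'I_n -> M) :
  \sum_(j | 0 < u j) \sum_(k | ~~ (0 < u k)) ((w j * w k / Sm * - u k) *: F j
     + (w j * w k / Sm * u j) *: F k) +
  \sum_j W (inl j) *: F j = \sum_j w j *: F j.
  have [Smz|Smn] := eqVneq Sm 0.
    rewrite big1 ?add0r; last first.
      by move=> i ui; apply: big1 => k uk; rewrite Smz invr0 !(mulr0, mul0r) !scale0r addr0.
    apply: eq_bigr => i _ /=; rewrite Smz eqxx; case: ifP => // _.
    by rewrite invr0 mulr0 subr0 mulr1.
  under eq_bigr do rewrite big_split /=.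
  rewrite big_split /= [in X in _ + X + _]exchange_big /=.
  rewrite [X in _ + X](bigID (fun i => 0 < u i)) /= [RHS](bigID (fun i => 0 < u i)) /=.
  rewrite [X in _ + (X + _)]big1 ?add0r; last first.
    by move=> i ui; rewrite ui (negPf Smn) scale0r.
  rewrite -addrA -big_split /=; congr (_ + _); apply: eq_bigr => i ui.
    rewrite -scaler_suml; congr (_ *: _).
    rewrite -[RHS](mulfK Smn) mulrAC; rewrite {2}/Sm mulr_sumr.
    by apply: eq_bigr => k _; ring.
  rewrite -scaler_suml (negPf ui) -scalerDl; congr (_ *: _).
  have -> : \sum_(i0 | 0 < u i0) w i0 * w i / Sm * u i0 = w i * (Sp / Sm).
    rewrite /Sp mulr_suml mulr_sumr; apply: eq_bigr => k _; ring.
  ring.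
(* Stated for any module, so that one computation gives both the total mass (a constant family) and
   the barycentre (the points themselves). *)
have sumWW (M : lmodType R) (F : 'I_n -> M) (G : 'I_n -> 'I_n -> M) :
    (forall i k, 0 < u i -> ~~ (0 < u k) -> (w i * w k / Sm * - u k) *: F i
     + (w i * w k / Sm * u i) *: F k = (w i * w k / Sm * (u i - u k)) *: G i k) ->
  \sum_k W (inl k) *: F k + \sum_k W (inr k) *: G k.1 k.2 = \sum_j w j *: F j.
  move=> FG; rewrite -sumW addrC; congr (_ + _).
  transitivity (\sum_k W (inr (k.1, k.2)) *: G k.1 k.2); first by apply: eq_bigr => -[].
  rewrite -(pair_bigA _ (fun i j => W (inr (i, j)) *: G i j)) /= [LHS](bigID (fun i => 0 < u i)) /=.
  rewrite [X in _ + X]big1 ?addr0; last first.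
    by move=> i ui; apply: big1 => k _; rewrite (negPf ui) scale0r.
  apply: eq_bigr => i ui; rewrite [RHS]big_mkcond /=; apply: eq_bigr => k _.
  by rewrite ui /=; case: ifP => [uk|_]; rewrite ?scale0r // FG.
have W1 : \sum_k W k = 1.
  rewrite big_sumType -w1.
  have e := sumWW R^o (fun _ => 1) (fun _ _ => 1).
  rewrite -!scaler_suml -scalerDl in e.
  have E (a b : R) : a *: (1 : R^o) = b *: (1 : R^o) -> a = b.
    by rewrite /GRing.scale /= !mulr1.
  by apply: E; rewrite -e // => i k _ _; rewrite -scalerDl -mulrDr [- _ + _]addrC.
have xQ : x = \sum_k W k *: Q k.
  rewrite big_sumType /= xE -(sumWW _ p (fun i k => mix (p i) (p k))).
    by congr (_ + _); apply: eq_bigr => -[].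
  move=> i k ui; rewrite -leNgt => uk; rewrite /mix scalerDr !scalerA -/(u i) -/(u k).
  have n0 : u i - u k != 0 by apply: lt0r_neq0; lra.
  have E (a b : R) : a * b = a * (u i - u k) * (b / (u i - u k)) by field.
  by rewrite -!E.
rewrite xQ; apply: conv_fin => // -[j|[i j]] /= Wn.
  rewrite mem_cat mem_filter pV andbT; apply/orP; left.
  move: Wn; case: ltP => // uj; case: ifP => [/eqP /wz /(_ uj) ->|]; by rewrite eqxx.
move: Wn; case: ifP; last by rewrite eqxx.
move=> /andP[ui]; rewrite -leNgt => uj _; rewrite mem_cat; apply/orP; right.
by apply/allpairsP; exists (p i, p j); rewrite !mem_filter !pV !andbT.
Qed.

Lemma rat_polytope_cuts (K : pset R m) s : rat_polytope K ->
  rat_polytope (fun x => K x /\ sat s x).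
Proof.
move=> Kr; elim: s => [|c s IH].
  have [n [q [qr KE]]] := Kr; exists n, q; split=> // x; rewrite -KE.
  by split=> [[]|] //.
have [n [q [qr KE]]] := rat_polytope_cut c IH; exists n, q; split=> // x; rewrite -KE.
split=> [[Kx sx]|[[Kx sx] cx]].
  split; last by apply: sx; rewrite mem_head.
  by split=> // d ds; apply: sx; rewrite in_cons ds orbT.
by split=> // d; rewrite in_cons => /orP[/eqP ->|/sx].
Qed.

End Polyhedra.

(** * Affine dimension as the rank of a matrix of differences *)

Section Dimension.
Variables (R : realType) (m : nat).
Implicit Types (S K F : pset R m) (x y : point R m).

Lemma affdim_ge_le S j k : (j <= k)%N -> affdim_ge S k -> affdim_ge S j.
Proof.
move=> jk [n [p0 [p [Sp0 [Sp kr]]]]].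
by exists n, p0, p; split=> //; split=> //; exact: leq_trans kr.
Qed.

Lemma affdim_exists S x : S x -> exists d, affdim S d.
Proof.
move=> Sx; pose P k := `[< affdim_ge S k >].
have ex0 : exists k, P k.
  by exists 0%N; apply/asboolP; exists 0%N, x, (fun _ => x).
have ub k : P k -> (k <= m)%N.
  by move=> /asboolP [n [p0 [p [_ [_ kr]]]]]; exact: leq_trans kr (rank_leq_col _).
case: (ex_maxnP ex0 ub) => d /asboolP Pd dmax; exists d; split=> // Pd1.
by have := dmax d.+1; rewrite ltnn => /(_ (introT (asboolP _) Pd1)).
Qed.

Lemma affdim_uniq_le S d k : affdim S d -> affdim_ge S k -> (k <= d)%N.
Proof.
move=> [_ Nd] Sk; rewrite leqNgt; apply/negP => dk; apply: Nd.
exact: affdim_ge_le Sk.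
Qed.

Lemma affdim_nonempty S d : affdim S d -> exists x, S x.
Proof. by move=> [[n [p0 [p [Sp0 _]]]] _]; exists p0. Qed.

Lemma row_diff_mx n p0 (p : 'I_n -> point R m) i : row i (diff_mx p0 p) = p i - p0.
Proof. by apply/rowP => j; rewrite !mxE. Qed.

Lemma rank_adds_notin n (M : 'M[R]_(n, m)) (v : 'rV[R]_m) :
  ~~ (v <= M)%MS -> (\rank M < \rank (M + v)%MS)%N.
Proof.
move=> vM; apply: rank_ltmx; rewrite ltmxE addsmxSl addsmx_sub submx_refl.
exact: vM.
Qed.

Lemma affdim_ge_extend S n p0 (p : 'I_n -> point R m) y :
  S p0 -> (forall i, S (p i)) -> S y -> ~~ (y - p0 <= diff_mx p0 p)%MS ->
  affdim_ge S (\rank (diff_mx p0 p)).+1.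
Proof.
move=> Sp0 Sp Sy yn.
pose p' (i : 'I_(n + 1)) := match split i with inl j => p j | inr _ => y end.
exists (n + 1)%N, p0, p'; split=> //; split.
  by move=> i; rewrite /p'; case: (split i).
have -> : diff_mx p0 p' = col_mx (diff_mx p0 p) (y - p0).
  apply/matrixP => i j; rewrite !mxE /p'; by case: (split i) => k; rewrite ?ord1 !mxE.
by rewrite -addsmxE; exact: rank_adds_notin.
Qed.

Lemma span_sum n p0 (p : 'I_n -> point R m) (v : 'rV[R]_m) :
  (v <= diff_mx p0 p)%MS -> exists w : 'I_n -> R, v = \sum_i w i *: (p i - p0).
Proof.
move=> /submxP [D ->]; exists (fun i => D 0 i); rewrite mulmx_sum_row.
by apply: eq_bigr => i _; rewrite row_diff_mx.
Qed.

Lemma span_aff S n p0 (p : 'I_n -> point R m) x :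
  S p0 -> (forall i, S (p i)) -> (x - p0 <= diff_mx p0 p)%MS -> aff S x.
Proof.
move=> Sp0 Sp /span_sum [w xE].
have -> : x = p0 + \sum_i w i *: (p i - p0) by rewrite -xE addrC subrK.
apply: (big_rec (fun v => aff S (p0 + v))) => [|i v _ Sv].
  by rewrite addr0; exact: sub_aff.
by rewrite addrCA addrC; apply: aff_affine => //; exact: sub_aff.
Qed.

Lemma span_dot0 n p0 (p : 'I_n -> point R m) (v a : 'rV[R]_m) b :
  (forall i, dot a (p i) = b) -> dot a p0 = b ->
  (v <= diff_mx p0 p)%MS -> dot a v = 0.
Proof.
move=> ap a0 /span_sum [w ->]; rewrite dot_sumr big1 // => i _.
by rewrite dotBr ap a0 subrr mulr0.
Qed.

(** A family reaching the dimension spans all directions: a point of [K] outside its span would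
    raise the rank. *)
Lemma affdim_span K r n p0 (p : 'I_n -> point R m) : affdim K r ->
  K p0 -> (forall i, K (p i)) -> (r <= \rank (diff_mx p0 p))%N ->
  forall x, aff K x -> (x - p0 <= diff_mx p0 p)%MS.
Proof.
move=> Kr Kp0 Kp rM x [k [q [w [Kq [w1 ->]]]]].
have -> : \sum_i w i *: q i - p0 = \sum_i w i *: (q i - p0).
  under [in RHS]eq_bigr do rewrite scalerBr.
  by rewrite sumrB -scaler_suml w1 scale1r.
apply: summx_sub => i _; apply: scalemx_sub; apply: contraT => qn.
have := affdim_uniq_le Kr (affdim_ge_extend Kp0 Kp (Kq i) qn).
by rewrite ltnNge rM.
Qed.

(** If [x] were outside the affine hull of [F], then [x] and the point [y] off the hyperplane would
    add two independent directions to the [d] directions of [F], too many for [K]. *)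
Lemma codim1_aff K F d a b : affdim K d.+1 -> affdim F d ->
  (forall x, F x -> K x) -> (forall x, F x -> dot a x = b) ->
  (exists2 y, K y & dot a y != b) ->
  forall x, aff K x -> dot a x = b -> aff F x.
Proof.
move=> Kd Fd FK Fab [y Ky yb] x Ax xb.
have [[n [p0 [p [Kp0 [Kp pr]]]]] _] := Kd.
have [[k [f0 [f [Ff0 [Ff fr]]]]] _] := Fd.
apply: (span_aff Ff0 Ff); apply: contraT => xn.
have yn : ~~ (y - f0 <= diff_mx f0 f + (x - f0))%MS.
  apply/negP => /sub_addsmxP [[u1 u2] /= yE].
  have : dot a (y - f0) = 0.
    have e1 : dot a (u1 *m diff_mx f0 f) = 0.
      by apply: (span_dot0 (p0 := f0) (p := f) (b := b)); rewrite ?submxMl ?Fab // => i; exact: Fab.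
    rewrite yE dotDr e1 add0r [u2]mx11_scalar mul_scalar_mx dotZr dotBr xb Fab //.
    by rewrite subrr mulr0.
  by move/eqP; rewrite dotBr subr_eq0 (Fab f0) // (negPf yb).
have r1 := rank_adds_notin xn; have r2 := rank_adds_notin yn.
have dirK z z' : aff K z -> aff K z' -> (z - z' <= diff_mx p0 p)%MS.
  move=> Az Az'; have -> : z - z' = (z - p0) - (z' - p0) by rewrite opprB addrA subrK.
  by apply: addmx_sub; rewrite ?eqmx_opp; apply: (affdim_span Kd).
have sub : (diff_mx f0 f + (x - f0) + (y - f0) <= diff_mx p0 p)%MS.
  rewrite !addsmx_sub -andbA; apply/and3P; split.
  - by apply/row_subP => i; rewrite row_diff_mx; apply: dirK; apply: sub_aff; exact: FK.
  - by apply: dirK => //; apply: sub_aff; exact: FK.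
  - by apply: dirK; apply: sub_aff => //; exact: FK.
have := mxrankS sub; rewrite leqNgt => /negP[].
have pd : (\rank (diff_mx p0 p) <= d.+1)%N.
  by apply: (affdim_uniq_le Kd); exists n, p0, p.
by apply: (leq_ltn_trans pd); apply: leq_ltn_trans r2; exact: leq_ltn_trans r1.
Qed.

End Dimension.

(** * Faces and facets of a polyhedron given by integral inequalities inside an affine set *)

Section Facets.
Variables (R : realType) (m : nat).
Implicit Types (x y p q v a : point R m) (c : constr m) (s : seq (constr m)).
Implicit Types (A K F G : pset R m).

Definition ival c x : R := idot c.1 x.
Definition ibound c : R := c.2%:~R.
Definition strict s x : Prop := forall c, c \in s -> ival c x < ibound c.
Definition hpoly A s : pset R m := fun x => A x /\ sat s x.
Definition nonconst A a : Prop := exists x y, A x /\ A y /\ dot a x <> dot a y.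
Definition convex_set K : Prop :=
  forall x y (t : R), K x -> K y -> 0 <= t <= 1 -> K (x + t *: (y - x)).

Lemma ival_line c x p q t : ival c (x + t *: (p - q)) = ival c x + t * (ival c p - ival c q).
Proof. exact: dot_line. Qed.

Lemma satE s x : sat s x <-> forall c, c \in s -> ival c x <= ibound c.
Proof. by []. Qed.

Lemma strict_sat s x : strict s x -> sat s x.
Proof. by move=> h c /h /ltW. Qed.

Lemma hpoly_convex A s : affine A -> convex_set (hpoly A s).
Proof.
move=> Aa x y t [Ax sx] [Ay sy] /andP[t0 t1]; split; first exact: Aa.
apply/satE => c cs; rewrite ival_line.
have := sx c cs; have := sy c cs; rewrite -!/(ival _ _) -/(ibound c) => h1 h2.
by nra.
Qed.

Lemma strict_room s x v : strict s x ->
  exists e : R, 0 < e /\ forall t, `|t| <= e -> strict s (x + t *: v).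
Proof.
move=> H; have Hv c t : ival c (x + t *: v) = ival c x + t * ival c v.
  by rewrite -[v]subr0 ival_line subr0 /ival /idot dot0r subr0.
elim: s H => [|c s IH] H; first by exists 1; split.
have [|e [e0 He]] := IH; first by move=> d ds; apply: H; rewrite in_cons ds orbT.
have Hc : ival c x < ibound c by apply: H; exact: mem_head.
pose k := `|ival c v| + 1.
have k0 : 0 < k by rewrite ltr_wpDl.
exists (Num.min e ((ibound c - ival c x) / 2 / k)); split.
  by rewrite lt_min e0 !divr_gt0 // subr_gt0.
move=> t; rewrite le_min => /andP[te tk] d; rewrite in_cons => /orP[/eqP ->|ds]; last exact: He.
rewrite Hv -ltrBrDl; apply: le_lt_trans (ler_norm _) _.
rewrite normrM; move: tk; rewrite ler_pdivlMr // => tk.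
have : `|t| * `|ival c v| <= `|t| * k by rewrite ler_wpM2l // lerDl.
move=> h; apply: (le_lt_trans h); apply: (le_lt_trans tk); lra.
Qed.

(** Midpoints accumulate strictness: an inequality strict at one end is strict in the middle, since
    the other end satisfies it. *)
Lemma common_strict F s x0 : convex_set F -> (forall x, F x -> sat s x) -> F x0 ->
  (forall c, c \in s -> exists2 x, F x & ival c x < ibound c) ->
  exists2 x, F x & strict s x.
Proof.
move=> Fc; elim: s => [|c s IH] Fs Fx0 H; first by exists x0.
have [||x Fx xs] := IH _ Fx0.
- by move=> x /Fs h d ds; apply: h; rewrite in_cons ds orbT.
- by move=> d ds; apply: H; rewrite in_cons ds orbT.
have [y Fy yc] := H c (mem_head _ _).
exists (x + 2^-1 *: (y - x)); first by apply: Fc => //; lra.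
move=> d dcs; rewrite ival_line.
have := Fs _ Fx d dcs; have := Fs _ Fy d dcs; rewrite -!/(ival _ _) -/(ibound d).
move: dcs; rewrite in_cons => /orP[/eqP ->|/xs]; lra.
Qed.

(** An inequality without a point violating it alone follows from the others on [A] and is removed;
    induction on the length of the system. *)
Lemma irredundant A s : exists s', [/\ forall c, c \in s' -> c \in s,
  forall x, A x -> sat s' x -> sat s x &
  forall c, c \in s' -> exists x, A x /\ ibound c < ival c x /\
    forall d, d \in s' -> d != c -> ival d x <= ibound d].
Proof.
have [n] := ubnP (size s); elim: n s => // n IH s /ltnSE sn.
have [H|] := pselect (forall c, c \in s -> exists x, A x /\ ibound c < ival c x /\
    forall d, d \in s -> d != c -> ival d x <= ibound d).
  by exists s; split.
move=> /existsPNP [c cs /forallNP H].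
have [|s' [s's s'A s'i]] := IH [seq d <- s | d != c].
  apply: leq_trans sn; rewrite size_filter -(count_predC (fun d => d != c) s).
  rewrite -[X in (X < _)%N]addn0 ltn_add2l -has_count; apply/hasP; exists c => //=.
  by rewrite eqxx.
exists s'; split=> // [d /s's|x Ax xs']; first by rewrite mem_filter => /andP[].
have xs := s'A x Ax xs'.
have xd d : d \in s -> d != c -> ival d x <= ibound d.
  by move=> ds dc; apply: xs; rewrite mem_filter dc.
move=> d ds; have [->|dc] := eqVneq d c; last exact: xd.
by rewrite leNgt; apply/negP => xc; apply: (H x).
Qed.

Section Full.
Variables (A : pset R m) (s : seq (constr m)).
Let K := hpoly A s.
Hypothesis Aa : affine A.
Hypothesis Kfull : forall x, A x -> aff K x.
Hypothesis snc : forall c, c \in s -> nonconst A (map_mx intr c.1).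

Lemma aff_hpoly x : aff K x <-> A x.
Proof.
split=> [Kx|]; last exact: Kfull.
by apply: affine_sum => //; apply: aff_sub Kx => y [].
Qed.

Lemma full_nonconst a b : nonconst A a -> exists2 x, K x & dot a x != b.
Proof.
move=> [x [y [Ax [Ay xy]]]]; apply: contrapT => H; apply: xy.
have Kb z : K z -> dot a z = b.
  by move=> Kz; apply: contrapT => zb; apply: H; exists z => //; exact/eqP.
by rewrite !(aff_const Kb) //; exact: Kfull.
Qed.

Lemma full_strict1 c : c \in s -> exists2 x, K x & ival c x < ibound c.
Proof.
move=> cs; have [x Kx xb] := full_nonconst (ibound c) (snc cs).
by exists x => //; rewrite lt_neqAle xb; apply: Kx.2.
Qed.

Lemma full_strict x0 : K x0 -> exists2 x, K x & strict s x.
Proof.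
move=> Kx0; apply: common_strict Kx0 full_strict1; first exact: hpoly_convex.
by move=> x [].
Qed.

Lemma strict_relint x : A x -> strict s x -> relint K x.
Proof.
move=> Ax xs; split; first by split=> //; exact: strict_sat.
have : exists e : R, 0 < e /\ forall y, (forall i, `|y 0 i - x 0 i| < e) -> sat s y.
  elim: (s) xs => [|c s' IH] xs; first by exists 1; split.
  have [|e [e0 He]] := IH; first by move=> d ds; apply: xs; rewrite in_cons ds orbT.
  have xc := xs c (mem_head _ _).
  pose k := \sum_i `|(c.1 0 i)%:~R : R| + 1.
  have k0 : 0 < k by rewrite ltr_wpDl // sumr_ge0.
  exists (Num.min e ((ibound c - ival c x) / k)); split.
    by rewrite lt_min e0 divr_gt0 // subr_gt0.
  move=> y yx d; rewrite in_cons => /orP[/eqP ->|ds]; last first.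
    by apply: He ds => i; apply: lt_le_trans (yx i) _; rewrite ge_min lexx.
  rewrite -/(ival c y) -/(ibound c).
  have -> : ival c y = ival c x + ival c (y - x).
    by rewrite /ival /idot dotBr addrC subrK.
  rewrite -lerBrDl; apply: le_trans (ler_norm _) _.
  apply: le_trans (ler_norm_sum _ _ _) _.
  have : \sum_i `|(c.1 0 i)%:~R : R| * ((ibound c - ival c x) / k) <= ibound c - ival c x.
    rewrite -mulr_suml mulrA ler_pdivrMr // mulrC ler_wpM2l ?lerDl //.
    by rewrite subr_ge0 ltW.
  apply: le_trans; apply: ler_sum => i _; rewrite !mxE normrM ler_wpM2l //.
  by apply: le_trans (ltW (yx i)) _; rewrite ge_min lexx orbT.
move=> [e [e0 He]]; exists e; split=> // y /aff_hpoly Ay yx; split=> //; exact: He.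
Qed.

(** From a tight point, a small step away from a point where the inequality is strict stays in [A]
    but leaves [K]. *)
Lemma relint_strict x : relint K x -> strict s x.
Proof.
move=> [[Ax sx] [e [e0 He]]] c cs.
have xc : ival c x <= ibound c by exact: sx.
rewrite lt_neqAle xc andbT; apply/eqP => xE.
have [y Ky yc] := full_strict1 cs.
pose k := \sum_i `|x 0 i - y 0 i| + 1.
have k0 : 0 < k by rewrite ltr_wpDl // sumr_ge0.
have t0 : 0 < e / k by rewrite divr_gt0.
have [] : K (x + (e / k) *: (x - y)).
  apply: He; first by apply/aff_hpoly; apply: Aa => //; case: Ky.
  move=> i; rewrite !mxE addrAC subrr add0r normrM gtr0_norm // mulrAC ltr_pdivrMr //.
  rewrite ltr_pM2l // /k (bigD1 i) //= -addrA ltrDl ltr_wpDl //.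
  by apply: sumr_ge0.
move=> _ /(_ c cs); rewrite -/(ival _ _) -/(ibound c) ival_line xE => h.
by have := mulr_gt0 t0 (_ : 0 < ibound c - ival c y); lra.
Qed.

(** Otherwise some point of the face is strict for every inequality. It can then be pushed slightly
    away from [y0] inside [K], which raises [dot a] above its maximum [b]. *)
Lemma face_in_constr a b x0 y0 : (forall x, K x -> dot a x <= b) ->
  K x0 -> dot a x0 = b -> K y0 -> dot a y0 < b ->
  exists2 c, c \in s & forall x, K x -> dot a x = b -> ival c x = ibound c.
Proof.
move=> Kab Kx0 x0b Ky0 y0b; apply: contrapT => H.
pose F : pset R m := fun x => K x /\ dot a x = b.
have [||||x [Kx xb] xs] := @common_strict F s x0.
- move=> x y t [Kx xb] [Ky yb] t01; split; first exact: hpoly_convex.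
  by rewrite dot_line xb yb subrr mulr0 addr0.
- by move=> x [[]].
- by [].
- move=> c cs; apply: contrapT => Hc; apply: H; exists c => // x Kx xb.
  apply: contrapT => /eqP xc; apply: Hc; exists x => //.
  by rewrite lt_neqAle xc; exact: Kx.2.
have [e [e0 He]] := strict_room (x - y0) xs.
have := He e; rewrite gtr0_norm // lexx => /(_ isT) /strict_sat es.
have : K (x + e *: (x - y0)) by split=> //; apply: Aa => //; [case: Kx|case: Kx|case: Ky0].
move=> /Kab; rewrite dot_line xb => h.
by have := mulr_gt0 e0 (_ : 0 < b - dot a y0); lra.
Qed.

Lemma facet_nonempty F : facet K F -> exists2 x, F x & K x.
Proof.
move=> [[a [b [_ FE]]] [d [_ /affdim_nonempty [x Fx]]]].
by exists x => //; have /FE [] := Fx.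
Qed.

Lemma facet_sub F x : facet K F -> F x -> K x.
Proof. by move=> [[a [b [_ FE]]] _] /FE []. Qed.

Lemma facet_constr F : facet K F ->
  exists2 c, c \in s & forall x, F x -> ival c x = ibound c.
Proof.
move=> Ff; have [x0 Fx0 Kx0] := facet_nonempty Ff.
case: Ff => [[a [b [Kab FE]]] [d [Kd Fd]]].
have [y0 Ky0 y0b] : exists2 y, K y & dot a y < b.
  apply: contrapT => H; have : affdim_ge F d.+1.
    have [[n [p0 [p [Kp0 [Kp pr]]]]] _] := Kd.
    have KF x : K x -> F x.
      move=> Kx; apply/FE; split=> //; apply/le_anti; rewrite Kab //= leNgt.
      by apply/negP => xb; apply: H; exists x.
    by exists n, p0, p; split; [exact: KF|split=> // i; exact: KF].
  by case: Fd.
have [c cs H] := face_in_constr Kab Kx0 (proj2 (proj1 (FE _) Fx0)) Ky0 y0b.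
by exists c => // x /FE [Kx xb]; exact: H.
Qed.

(** This places every integer point of [A] on the hyperplane of a facet in the affine hull of that
    facet. *)
Lemma facet_aff F c : facet K F -> c \in s -> (forall x, F x -> ival c x = ibound c) ->
  forall x, A x -> ival c x = ibound c -> aff F x.
Proof.
move=> Ff cs Fc x Ax; have [_ [d [Kd Fd]]] := Ff.
apply: (codim1_aff Kd Fd (fun x => @facet_sub F x Ff) Fc); last exact: Kfull.
by have [y Ky yc] := full_strict1 cs; exists y => //; rewrite lt_eqF.
Qed.

End Full.

(** The segment from the strict point [x0] to [x1], which violates [c] alone, meets the hyperplane
    of [c] at a point [p] strict for the other inequalities. Around [p] the section of [A] by the
    hyperplane lies in the face, so the face has all directions of [K] but one. *)
Lemma irredundant_facet A s c x0 x1 : let K := hpoly A s in affine A ->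
  c \in s -> A x0 -> strict s x0 ->
  A x1 -> ibound c < ival c x1 -> (forall d, d \in s -> d != c -> ival d x1 <= ibound d) ->
  facet K (fun x => K x /\ ival c x = ibound c).
Proof.
move=> K Aa cs Ax0 x0s Ax1 x1c x1d.
split.
  by exists (map_mx intr c.1), (ibound c); split=> // x Kx; apply: Kx.2.
set F := fun x => _.
have x0c := x0s c cs.
pose t := (ibound c - ival c x0) / (ival c x1 - ival c x0).
have tn : 0 < ival c x1 - ival c x0 by lra.
have t0 : 0 < t by rewrite divr_gt0 // subr_gt0.
have t1 : t < 1 by rewrite ltr_pdivrMr // mul1r; lra.
pose p := x0 + t *: (x1 - x0).
have pc : ival c p = ibound c by rewrite ival_line /t divfK ?gt_eqF // addrC subrK.
have Ap : A p by exact: Aa.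
pose s' := [seq d <- s | d != c].
have ps' : strict s' p.
  move=> d; rewrite mem_filter => /andP[dc ds]; rewrite ival_line.
  have := x0s d ds; have := x1d d ds dc => h1 h2; nra.
have FI x : A x -> ival c x = ibound c -> strict s' x -> F x.
  move=> Ax xc xs'; split=> //; split=> // d ds.
  have [->|dc] := eqVneq d c; first by rewrite -/(ival c x) xc.
  by apply: ltW; apply: xs'; rewrite mem_filter dc.
have Fp : F p by exact: FI.
have Kx0 : K x0 by split=> //; exact: strict_sat.
have [d Fd] := affdim_exists Fp.
have [r Kr] := affdim_exists Kx0.
suff rd : r = d.+1 by exists d; rewrite -rd.
apply/eqP; rewrite eqn_leq; apply/andP; split; last first.
  apply: (affdim_uniq_le Kr); have [[n [f0 [f [Ff0 [Ff fr]]]]] _] := Fd.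
  apply: (@affdim_ge_le _ _ _ _ (\rank (diff_mx f0 f)).+1) => //.
  apply: (affdim_ge_extend (y := x0)) => //; [by case: Ff0|by move=> i; case: (Ff i)|].
  apply/negP => /(@span_dot0 _ _ _ _ _ _ (map_mx intr c.1) (ibound c)).
  rewrite dotBr => /(_ (fun i => proj2 (Ff i)) (proj2 Ff0)).
  rewrite (proj2 Ff0 : dot _ f0 = _) -/(idot c.1 x0) -/(ival c x0); lra.
have [[n [p0 [q [Kp0 [Kq qr]]]]] _] := Kr.
pose u := x0 - p.
have uc : ival c u < 0.
  by rewrite /u /ival /idot dotBr -!/(idot _ _) -!/(ival _ _) pc subr_lt0.
have ivalB y z : ival c (y - z) = ival c y - ival c z by exact: dotBr.
have ivalZ k z : ival c (k *: z) = k * ival c z by exact: dotZr.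
have ivalD y z : ival c (y + z) = ival c y + ival c z by exact: dotDr.
(* Each direction of [K] is a multiple of [u], which leaves the hyperplane, plus a direction [v i]
   along it; a short step along [v i] from [p] remains in the face. *)
pose la i := ival c (q i - p0) / ival c u.
pose v i := (q i - p0) - la i *: u.
have vc i : ival c (v i) = 0.
  by rewrite ivalB ivalZ /la divfK ?lt_eqF // subrr.
have : forall i, exists e : R, 0 < e /\ F (p + e *: v i).
  move=> i; have [e [e0 He]] := strict_room (v i) ps'.
  exists e; split=> //; apply: FI; last by apply: He; rewrite gtr0_norm.
    rewrite /v /u scalerBr addrA scalerA -scaleNr.
    by apply: (Aa) => //; apply: (Aa) => //; [case: (Kq i)|case: Kp0].
  by rewrite ivalD ivalZ vc mulr0 addr0.
move=> /fin_all_exists [e He].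
pose g i := p + e i *: v i.
have gF i : F (g i) by case: (He i).
have gd : (\rank (diff_mx p g) <= d)%N by apply: (affdim_uniq_le Fd); exists n, p, g.
apply: (leq_trans qr).
apply: (@leq_trans (\rank (diff_mx p g + u)%MS)).
  apply: mxrankS; apply/row_subP => i; rewrite row_diff_mx.
  have -> : q i - p0 = (e i)^-1 *: (g i - p) + la i *: u.
    have e0 : e i != 0 by case: (He i) => /lt0r_neq0.
    by rewrite /g (addrC p) addrK scalerA mulVf // scale1r /v subrK.
  apply: addmx_sub; apply: scalemx_sub; last exact: addsmxSr.
  by apply: submx_trans (addsmxSl _ _); rewrite -row_diff_mx row_sub.
apply: leq_trans (mxrank_adds_leqif _ _) _; rewrite -(addn1 d).
by apply: leq_add => //; exact: rank_leq_row.
Qed.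

(** Some inequality is tight on the whole exposed face. Choosing it in an irredundant subsystem
    makes it define a facet. This is the means by which a face of the integer hull is placed in a
    facet of the polytope. *)
Lemma exposed_facet A s a b x0 y0 : let K := hpoly A s in affine A ->
  (forall x, A x -> aff K x) -> (forall c, c \in s -> nonconst A (map_mx intr c.1)) ->
  (forall x, K x -> dot a x <= b) -> K x0 -> dot a x0 = b -> K y0 -> dot a y0 < b ->
  exists2 F, facet K F & forall x, K x -> dot a x = b -> F x.
Proof.
move=> K Aa Kf snc Kab Kx0 x0b Ky0 y0b.
have [s' [s's s'A s'i]] := irredundant A s.
have KE x : hpoly A s' x <-> K x.
  split=> -[Ax xs]; split=> //; first exact: s'A.
  by move=> c /s's /xs.
have Kf' x : A x -> aff (hpoly A s') x by move=> /Kf; apply: aff_sub => y /KE.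
have snc' c : c \in s' -> nonconst A (map_mx intr c.1) by move=> /s's /snc.
have [c cs' H] := face_in_constr Aa (fun x h => Kab x (proj1 (KE x) h))
  (proj2 (KE _) Kx0) x0b (proj2 (KE _) Ky0) y0b.
have [z /KE Kz zs] := full_strict Aa Kf' snc' (proj2 (KE _) Kx0).
have [x1 [Ax1 [x1c x1d]]] := s'i c cs'.
have KK : hpoly A s' = K by apply/funext => x; apply/propext; exact: KE.
have := irredundant_facet Aa cs' (proj1 Kz) zs Ax1 x1c x1d; rewrite /= KK => Ff.
by eexists; [exact: Ff|] => x Kx xb; split=> //; apply: H => //; exact/KE.
Qed.

End Facets.

(** * Splits, integer hulls and the splits attached to facets *)

Section Splits.
Variables (R : realType) (m : nat).
Implicit Types (x y z a : point R m) (c : constr m) (F G : pset R m).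

(** The position in which [K] ends up when a facet lies on the first hyperplane and [K] misses the
    second one. *)
Definition in_half_open_slab (K : pset R m) a (b1 b2 : R) : Prop :=
  forall x, K x -> between b1 (dot a x) b2 /\ dot a x <> b2.

(* A point of the face is a convex combination of integer points of the face. *)
Lemma face_int_hull_level (P G : pset R m) a' k x : face (int_hull P) G ->
  (forall z, G z -> is_int_pt z -> dot a' z = k) -> G x -> dot a' x = k.
Proof.
move=> [a [b [Gab GE]]] Hk /GE [[n [p [w [Kp [w0 [w1 xE]]]]]] xb].
have pG i : w i != 0 -> G (p i).
  move=> wi; apply/GE; split; first by apply: sub_conv; exact: Kp.
  have pb j : dot a (p j) <= b by apply: Gab; apply: sub_conv; exact: Kp.
  have /psumr_eq0P : \sum_j w j * (b - dot a (p j)) = 0.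
    under eq_bigr do rewrite mulrBr.
    by rewrite sumrB -mulr_suml w1 mul1r -dot_sumr -xE xb subrr.
  have nn j : true -> 0 <= w j * (b - dot a (p j)) by rewrite mulr_ge0 // subr_ge0.
  move=> /(_ nn i isT) /eqP; rewrite mulf_eq0 (negPf wi) subr_eq0 /=.
  by move=> /eqP.
have kE : k = \sum_i w i * k by rewrite -mulr_suml w1 mul1r.
rewrite xE kE dot_sumr; apply: eq_bigr => i _.
have [->|wi] := eqVneq (w i) 0; first by rewrite !mul0r.
by rewrite Hk //; [exact: pG|case: (Kp i)].
Qed.

Variables (A : pset R m) (s : seq (constr m)).
Let K := hpoly A s.
Hypothesis Aa : affine A.
Hypothesis Kfull : forall x, A x -> aff K x.
Hypothesis snc : forall c, c \in s -> nonconst A (map_mx intr c.1).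

Lemma int_hull_sub x : int_hull K x -> K x.
Proof.
move=> [n [p [w [Kp [w0 [w1 ->]]]]]].
have cK : conv K (\sum_i w i *: p i).
  by exists n, p, w; split=> // i; case: (Kp i).
split; last by move=> c cs; apply: conv_le cK => y [_]; exact.
apply: affine_sum => //; exists n, p, w; split=> // i.
by have [[]] := Kp i.
Qed.

(** If the integer points of a face all lie on one of the two levels, so does the face. That level
    supports [K] and does not contain it, as [pi] is not constant on [A]; hence the face lies in a
    facet. *)
Lemma slab_two_hyperplane (pi : 'rV[int]_m) (pi0 : int) :
  nonconst A (map_mx intr pi) ->
  (forall x, K x -> pi0%:~R <= idot pi x <= (pi0 + 1)%:~R) ->
  two_hyperplane_property K.
Proof.
move=> pinc slab G [a [b [Gab GE]]] GF.
have [G0|] := pselect (forall x y, (G x /\ is_int_pt x) -> (G y /\ is_int_pt y) -> x = y).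
  by left.
move=> /existsNP [g0 /existsNP [g1 H]].
have [Gg0 g0i] : G g0 /\ is_int_pt g0 by apply: contrapT => n; apply: H.
have GK x : G x -> K x by move=> /GE [/int_hull_sub].
have level := face_int_hull_level (ex_intro _ a (ex_intro _ b (conj Gab GE))).
have two x : G x -> is_int_pt x -> idot pi x = pi0%:~R \/ idot pi x = (pi0 + 1)%:~R.
  move=> /GK /slab + [z xE]; rewrite xE idot_int !ler_int => /andP[h1 h2].
  have [h|h] := leP (zdot pi z) pi0.
    by left; congr (_%:~R); apply/le_anti; rewrite h h1.
  by right; congr (_%:~R); apply/le_anti; rewrite h2 /= lezD1.
right; exists pi, pi0, (fun x => (G x /\ is_int_pt x) /\ idot pi x = pi0%:~R),
  (fun x => (G x /\ is_int_pt x) /\ idot pi x = (pi0 + 1)%:~R).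
split.
  move=> x; split=> [[Gx xi]|[[] []|[] []]] //.
  by case: (two x Gx xi) => h; [left|right].
split.
  move=> x [_ ->] [_ /eqP]; rewrite eqr_int -subr_eq0.
  by rewrite opprD addrA subrr.
split.
  apply: contrapT => n; apply: GF.
  have G1 z : G z -> is_int_pt z -> idot pi z = (pi0 + 1)%:~R.
    by move=> Gz zi; case: (two z Gz zi) => // h; case: n; exists z.
  have [y Ky yb] := full_nonconst Kfull (pi0 + 1)%:~R pinc.
  have le1 x : K x -> dot (map_mx intr pi) x <= (pi0 + 1)%:~R by move=> /slab /andP[].
  have lt1 : dot (map_mx intr pi) y < (pi0 + 1)%:~R by rewrite lt_neqAle yb le1.
  have [F Ff FG] := exposed_facet Aa Kfull snc le1 (GK g0 Gg0) (G1 g0 Gg0 g0i) Ky lt1.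
  by exists F; split=> // x Gx; apply: FG; [exact: GK|exact: (level (map_mx intr pi) _ _ G1)].
split; last by split=> x [].
apply: contrapT => n; apply: GF.
have G1 z : G z -> is_int_pt z -> idot pi z = pi0%:~R.
  by move=> Gz zi; case: (two z Gz zi) => // h; case: n; exists z.
have [y Ky yb] := full_nonconst Kfull pi0%:~R pinc.
have idotNm x : dot (map_mx intr (- pi)) x = - idot pi x by exact: idotN.
have le0 x : K x -> dot (map_mx intr (- pi)) x <= - pi0%:~R.
  by move=> /slab /andP[h _]; rewrite idotNm lerN2.
have lt0 : dot (map_mx intr (- pi)) y < - pi0%:~R.
  by rewrite lt_neqAle le0 // andbT idotNm eqr_opp.
have eq0 : dot (map_mx intr (- pi)) g0 = - pi0%:~R by rewrite idotNm G1.
have [F Ff FG] := exposed_facet Aa Kfull snc le0 (GK g0 Gg0) eq0 Ky lt0.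
exists F; split=> // x Gx; apply: FG; first exact: GK.
by rewrite idotNm /idot (level (map_mx intr pi) _ _ G1).
Qed.

Hypothesis Aint : forall x, A x -> aff (fun z => A z /\ is_int_pt z) x.
Hypothesis satt : forall c, c \in s -> exists z, A z /\ is_int_pt z /\ ival c z = ibound R c.
Hypothesis thick : forall a b1 b2, split_within A a b1 b2 -> ~ in_half_open_slab K a b1 b2.

Lemma facet_int_pt F : facet K F -> exists z, aff F z /\ is_int_pt z.
Proof.
move=> Ff; have [c cs Fc] := facet_constr Aa Ff.
have [z [Az [zi zc]]] := satt cs; exists z; split=> //.
exact: (facet_aff Kfull snc Ff cs Fc Az zc).
Qed.

(** The form is integral on integer points, so its levels below the bound are numbered by positive
    naturals and the nearest one is a minimum. Some lower level exists, since otherwise the form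
    would be constant on the integer points, which span [A]. *)
Lemma next_int_level c z : c \in s -> A z -> is_int_pt z -> ival c z = ibound R c ->
  exists g : nat, [/\ (0 < g)%N, exists z', A z' /\ is_int_pt z' /\ ival c z' = ibound R c - g%:R
   & forall z', A z' -> is_int_pt z' -> ~ (ibound R c - g%:R < ival c z' < ibound R c)].
Proof.
move=> cs Az zi zc.
have ivalint y : is_int_pt y -> exists k : int, ival c y = k%:~R.
  by move=> [u ->]; exists (zdot c.1 u); exact: idot_int.
pose P g := `[< (0 < g)%N /\ exists z', A z' /\ is_int_pt z' /\ ival c z' = ibound R c - g%:R >].
have lower y : A y -> is_int_pt y -> ival c y < ibound R c -> exists2 g, P g & ival c y = ibound R c - g%:R.
  move=> Ay yi yc; have [k kE] := ivalint y yi.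
  have : k < c.2 by rewrite -(ltr_int R) -kE.
  move=> kc; have [g gE] : exists g : nat, c.2 - k = g%:Z.
    by exists `|c.2 - k|%N; rewrite gez0_abs // subr_ge0 ltW.
  have yE : ival c y = ibound R c - g%:R.
    by rewrite kE /ibound -[g%:R]/((g%:Z)%:~R) -gE -rmorphB /= subKr.
  exists g => //; apply/asboolP; split; last by exists y.
  by rewrite -ltz_nat -gE subr_gt0.
have exP : exists g, P g.
  apply: contrapT => nP; have [x [y [Ax [Ay]]]] := snc cs; apply.
  have const u : A u /\ is_int_pt u -> ival c u = ibound R c.
    move=> [Au ui]; apply: contrapT => /eqP; rewrite neq_lt => /orP[uc|uc].
      by have [g Pg _] := lower u Au ui uc; apply: nP; exists g.
    (* An integer point above the level is reflected through [z] to one below it. *)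
    have Ar : A (z + 1 *: (z - u)) by exact: Aa.
    have ri : is_int_pt (z + 1 *: (z - u)).
      by rewrite scale1r; apply: int_ptD => //; exact: int_ptB.
    have rc : ival c (z + 1 *: (z - u)) < ibound R c.
      by rewrite ival_line zc mul1r; lra.
    by have [g Pg _] := lower _ Ar ri rc; apply: nP; exists g.
  by rewrite (aff_const const (Aint Ax)) (aff_const const (Aint Ay)).
case: (ex_minnP exP) => g /asboolP [g0 [z' Hz']] gmin.
exists g; split=> //; first by exists z'.
move=> y Ay yi /andP[y1 y2]; have [k Pk yE] := lower y Ay yi y2.
have := gmin k Pk; rewrite leqNgt => /negP; apply.
by rewrite -(ltr_nat R); lra.
Qed.

(** The second hyperplane is the nearest lattice level on the inner side of the facet. This keeps
    the statement about all splits of a facet from being vacuous. *)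
Lemma facet_split_exists F : facet K F -> exists a b1 b2, facet_split A K F a b1 b2.
Proof.
move=> Ff; have [c cs Fc] := facet_constr Aa Ff.
have [z [Az [zi zc]]] := satt cs.
have [g [g0 [z' [Az' [z'i z'c]]] gmin]] := next_int_level cs Az zi zc.
have [x0 Fx0 Kx0] := facet_nonempty Ff.
have g0' : 0 < g%:R :> R by rewrite ltr0n.
exists (map_mx intr c.1), (ibound R c), (ibound R c - g%:R); split.
  split; first by apply: is_int_rat; exists c.1.
  split; first exact: snc.
  split; first by move=> h; lra.
  split; first by exists z.
  split; first by exists z'.
  by move=> y Ay yi [/andP[h1 h2]|h]; [lra|exact: gmin h].
exists (ibound R c); split=> //; split; first by right; lra.
have [y Ky yc] := full_strict1 Kfull snc cs.
have [h|h] := ltP (ibound R c - g%:R) (ival c y).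
  by exists y; split=> //; right; rewrite -/(idot _ _) -/(ival _ _) h yc.
(* When [y] lies on or beyond the second hyperplane, the segment from the facet to [y] is stopped
   halfway between the two levels. *)
pose t := g%:R / 2 / (ibound R c - ival c y).
have tn : 0 < ibound R c - ival c y by rewrite subr_gt0.
have t0 : 0 < t by rewrite !divr_gt0.
have t1 : t <= 1 by rewrite ler_pdivrMr // mul1r; lra.
exists (x0 + t *: (y - x0)); split; first by apply: hpoly_convex => //; lra.
right; rewrite -/(idot _ _) -/(ival _ _) ival_line (Fc x0) //.
have -> : t * (ival c y - ibound R c) = - (g%:R / 2).
  by rewrite -opprB mulrN /t divfK ?gt_eqF.
lra.
Qed.

Lemma facet_split_intersecting F a b1 b2 : facet K F -> facet_split A K F a b1 b2 ->
  split_intersecting K a b1 b2.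
Proof.
move=> Ff [sw [b0 [Fb0 [bb [y0 [Ky0 y0b]]]]]].
have [ar [anc [b12 [_ [_ nosb]]]]] := sw.
have [c cs Fc] := facet_constr Aa Ff.
have [x0 Fx0 Kx0] := facet_nonempty Ff.
have affF := facet_aff Kfull snc Ff cs Fc.
(* The affine hull of the facet contains an integer point, so its level is not strictly inside the
   split; it is not [b2] either, as [y0] lies strictly between. *)
have b01 : b0 = b1.
  have [z [Fz zi]] := facet_int_pt Ff.
  have Az : A z by apply/(aff_hpoly Aa Kfull); apply: aff_sub Fz => x; exact: facet_sub.
  have zb : dot a z = b0 by exact: aff_const Fz.
  have := nosb z Az zi; rewrite zb => nb.
  case: (ltgtP b0 b1) => // h; exfalso; apply: nb; move: bb y0b; rewrite /between /sbetween;
    by move=> [/andP[]|/andP[]] ? ? [/andP[]|/andP[]] ? ?; try (left; lra); right; lra.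
rewrite {}b01 {b0 bb} in Fb0 y0b *.
split; first by exists x0; rewrite Fb0.
apply: contrapT => noK; apply: (thick sw).
pose D := b2 - b1; pose phi x := (dot a x - b1) / D.
have D0 : D != 0 by rewrite subr_eq0; apply/eqP => h; apply: b12.
have phiE x : dot a x = b1 + phi x * D by rewrite /phi divfK // addrC subrK.
have y0phi : 0 < phi y0 < 1.
  rewrite /phi; case: y0b => /andP[h1 h2].
    have Dp : 0 < D by rewrite /D; lra.
    by rewrite divr_gt0 ?ltr_pdivrMr //= ?mul1r /D; lra.
  have Dn : D < 0 by rewrite /D; lra.
  by rewrite ltr_ndivlMr // ltr_ndivrMr // mul0r mul1r /D; lra.
have y0c : ival c y0 < ibound R c.
  rewrite lt_neqAle; apply/andP; split; last exact: Ky0.2.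
  apply/eqP => y0c; have := affF _ (proj1 Ky0) y0c => /(aff_const Fb0) h.
  by move: y0phi; rewrite /phi h subrr mul0r ltxx.
(* The segment from the facet, where [phi] is 0, to a point with [phi >= 1] would meet the second
   hyperplane inside [K]. *)
have phi1 x : K x -> phi x < 1.
  move=> Kx; rewrite ltNge; apply/negP => h; apply: noK.
  have p0 : 0 < phi x by lra.
  exists (x0 + (phi x)^-1 *: (x - x0)); split.
    by apply: hpoly_convex => //; rewrite invr_ge0 ltW //= invf_le1.
  by rewrite dot_line (Fb0 x0) // phiE addrAC subrr add0r mulrA mulVf ?gt_eqF // mul1r /D addrC subrK.
(* Otherwise [a] would be constant on a hyperplane section and at a point off it. *)
have phi0 x : K x -> 0 <= phi x.
  move=> Kx; rewrite leNgt; apply/negP => h.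
  pose t := phi y0 / (phi y0 - phi x).
  have tn : 0 < phi y0 - phi x by lra.
  have t0 : 0 < t by rewrite divr_gt0 //; lra.
  have t1 : t < 1 by rewrite ltr_pdivrMr // mul1r; lra.
  pose p := y0 + t *: (x - y0).
  have pb : dot a p = b1.
    have tE : t * (phi y0 - phi x) = phi y0 by rewrite /t divfK // gt_eqF.
    rewrite dot_line !phiE.
    transitivity (b1 + (phi y0 - t * (phi y0 - phi x)) * D); first ring.
    by rewrite tE subrr mul0r addr0.
  have Ap : A p by apply: Aa; [case: Ky0|case: Kx|case: Ky0].
  have pc : ival c p < ibound R c.
    rewrite ival_line; have := Kx.2 c cs; rewrite -/(ival _ _) -/(ibound R c) => h'.
    by nra.
  (* [dot a] agrees at [p] and [x0], so it does not change along [p - x0]; [r] takes [y0] in that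
     direction to the facet hyperplane, forcing [dot a y0 = b1]. *)
  pose r := (ibound R c - ival c y0) / (ival c p - ibound R c).
  have : aff F (y0 + r *: (p - x0)).
    apply: affF; first by apply: Aa => //; [case: Ky0|case: Kx0].
    by rewrite ival_line (Fc x0) // /r divfK ?lt_eqF ?subr_lt0 // addrC subrK.
  move=> /(aff_const Fb0); rewrite dot_line pb (Fb0 x0) // subrr mulr0 addr0 => h'.
  by move: y0phi; rewrite /phi h' subrr mul0r ltxx.
move=> x Kx; have h0 := phi0 x Kx; have h1 := phi1 x Kx.
rewrite /between !phiE; have -> : b2 = b1 + D by rewrite /D addrC subrK.
have [Dp|Dn|Dz] := ltgtP 0 D; last by rewrite -Dz eqxx in D0.
  by split; [left; apply/andP; split|]; nra.
by split; [right; apply/andP; split|]; nra.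
Qed.

End Splits.

(** * Lattice coordinates, integral boxes and the perturbation of an inequality *)

Section Lattice.
Variables (R : realType) (m : nat).
Implicit Types (x y z a : point R m).

Local Notation ipt := (map_mx (intr : int -> R)).

(* [e] is a basis of Z^m with dual basis [cc]; [A] is the coordinate subspace
   spanned by the [e i], [i \in I], translated by [z0]. *)
Record lattice_coords (A : pset R m) (z0 : 'rV[int]_m) (I : pred 'I_m)
    (e cc : 'I_m -> 'rV[int]_m) : Prop := LatticeCoords {
  lc_dual : forall i j, zdot (cc i) (e j) = (i == j)%:R;
  lc_expand : forall x, x = \sum_i idot (cc i) x *: ipt (e i);
  lc_mem : forall x, A x <->
    forall i, ~~ I i -> idot (cc i) x = (zdot (cc i) z0)%:~R }.

(** The directions between generators are scaled to integral rows of [E]. In its Smith form the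
    right factor [U] is unimodular: its rows are the basis and the columns of its inverse the dual
    basis. The integer point [z0] supplies the values of the fixed coordinates. *)
Lemma lattice_coords_exists (L : pset R m) (z0 : 'rV[int]_m) :
  rat_polytope L -> aff L (ipt z0) ->
  exists I e cc, lattice_coords (aff L) z0 I e cc.
Proof.
move=> /rat_polytopeP [V [Vr LE]] Lz0.
have LV q : q \in V -> aff L q by move=> qV; apply: sub_aff; apply/LE; exact: sub_conv.
have [q0 q0V] : exists q0, q0 \in V.
  apply: contrapT => nV; case: Lz0 => n [p [w [Lp [w1 _]]]].
  case: n p w Lp w1 => [|n] p w Lp w1.
    by move: w1; rewrite big_ord0 => /eqP; rewrite eq_sym oner_eq0.
  have /LE [k [r [u [rV [_ [u1 _]]]]]] := Lp ord0.
  case: k r u rV u1 => [|k] r u rV u1; last by apply: nV; exists (r ord0).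
  by move: u1; rewrite big_ord0 => /eqP; rewrite eq_sym oner_eq0.
pose n := size V.
have : forall i : 'I_n, exists Dp : int * 'rV[int]_m,
    0 < Dp.1 /\ Dp.1%:~R *: (V`_i - q0) = ipt Dp.2.
  move=> i; have [|D [p [D0 pE]]] := @rat_pt_denom _ _ (V`_i - q0); last by exists (D, p).
  have -> : V`_i - q0 = V`_i + ratr (-1) *: q0 by rewrite rmorphN rmorph1 scaleN1r.
  apply: rat_ptD; first by apply: Vr; exact: mem_nth.
  by apply: rat_ptZ; exact: Vr.
move=> /fin_all_exists [Dp HDp].
pose E : 'M[int]_(n, m) := \matrix_i (Dp i).2.
have [L0 L0u [U Uu [d _ EE]]] := int_Smith_normal_form E.
set Dm := \matrix_(i, j) _ in EE.
(* The indices of nonzero invariant factors; [j < n] discards entries of [d] beyond the rows of the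
   matrix. *)
pose I := [pred j : 'I_m | (j < n)%N && (d`_j != 0)].
pose W := invmx U.
have ccx (j : 'I_m) x : idot (\row_k W k j) x = (x *m map_mx intr W) 0 j.
  by rewrite /idot /dot !mxE; apply: eq_bigr => k _; rewrite !mxE mulrC.
exists I, (fun j => row j U), (fun j => \row_k W k j); split.
- move=> i j; transitivity ((U *m W) j i); last by rewrite mulmxV // mxE eq_sym.
  by rewrite mxE; apply: eq_bigr => k _; rewrite !mxE mulrC.
- move=> x; under eq_bigr do rewrite ccx.
  rewrite -[LHS]mulmx1.
  have -> : 1%:M = map_mx intr W *m map_mx intr U :> 'M[R]_m.
    by rewrite -map_mxM mulVmx // map_mx1.
  rewrite mulmxA mulmx_sum_row; apply: eq_bigr => i _; congr (_ *: _).
  by apply/rowP => j; rewrite !mxE.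
move=> x; split=> [Lx j nIj|H].
  have ccV q : q \in V -> idot (\row_k W k j) q = idot (\row_k W k j) q0.
    move=> /(nthP 0) [i iV <-]; have [D0 pE] := HDp (Ordinal iV).
    have D0' : (Dp (Ordinal iV)).1%:~R != 0 :> R by rewrite intr_eq0 gt_eqF.
    apply/eqP; rewrite -subr_eq0 /idot -dotBr -(mulrI_eq0 _ (mulfI D0')) -dotZr pE.
    rewrite -/(idot _ _) idot_int intr_eq0.
    have -> : zdot (\row_k W k j) (Dp (Ordinal iV)).2 = (E *m W) (Ordinal iV) j.
      by rewrite mxE; apply: eq_bigr => k _; rewrite !mxE mulrC.
    rewrite EE mulmxK // mxE big1 // => k _; rewrite mxE.
    case: (eqVneq (k : nat) j) => [kj|]; last by rewrite mulr0.
    by move: nIj; rewrite /I /= -kj ltn_ord /= negbK => /eqP ->; rewrite mul0rn mulr0.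
  have Lc y : L y -> dot (map_mx intr (\row_k W k j)) y = idot (\row_k W k j) q0.
    move=> /LE yc; apply: (aff_const (K := fun y => y \in V)) => //.
    by have [k [r [u [rV [_ Hu]]]]] := yc; exists k, r, u.
  by rewrite -idot_int /idot (aff_const Lc Lx) (aff_const Lc Lz0).
(* For a nonzero factor, a multiple of the basis row is an integral combination of rows of [E],
   hence a direction of the affine hull. *)
have step j y t : I j -> aff L y -> aff L (y + t *: ipt (row j U)).
  move=> /andP[jn dj] Ly.
  have rE : d`_j *: row j U = \sum_i (invmx L0) (Ordinal jn) i *: (Dp i).2.
    transitivity (row (Ordinal jn) (invmx L0 *m E)).
      rewrite EE -mulmxA mulKmx //; apply/rowP => k; rewrite !mxE (bigD1 j) //= !mxE eqxx.
      rewrite big1 ?addr0 // => l lj; rewrite !mxE.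
      by rewrite (_ : (_ == _) = false) ?mul0r //; apply/negbTE; rewrite eq_sym.
    rewrite row_mul mulmx_sum_row; apply: eq_bigr => i _; rewrite mxE; congr (_ *: _).
    by apply/rowP => k; rewrite !mxE.
  have -> : t *: ipt (row j U) = \sum_i (t / (d`_j)%:~R * (invmx L0 (Ordinal jn) i)%:~R
       * (Dp i).1%:~R) *: (V`_i - q0).
    have dj' : (d`_j)%:~R != 0 :> R by rewrite intr_eq0.
    transitivity ((t / (d`_j)%:~R) *: ipt (d`_j *: row j U)).
      by rewrite map_mxZ scalerA divfK.
    rewrite rE map_mx_sum scaler_sumr; apply: eq_bigr => i _.
    by rewrite map_mxZ scalerA -(proj2 (HDp i)) scalerA.
  elim/big_rec: _ => [|i v _ Lv]; first by rewrite addr0.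
  rewrite addrCA addrC; apply: aff_affine => //; first by apply: LV; exact: mem_nth.
  exact: LV.
have xE : x = ipt z0 + \sum_i (idot (\row_k W k i) x - (zdot (\row_k W k i) z0)%:~R) *: ipt (row i U).
  have expand y : y = \sum_i idot (\row_k W k i) y *: ipt (row i U).
    under eq_bigr do rewrite ccx.
    rewrite -[LHS]mulmx1.
    have -> : 1%:M = map_mx intr W *m map_mx intr U :> 'M[R]_m.
      by rewrite -map_mxM mulVmx // map_mx1.
    rewrite mulmxA mulmx_sum_row; apply: eq_bigr => i _; congr (_ *: _).
    by apply/rowP => j; rewrite !mxE.
  under eq_bigr do rewrite scalerBl -idot_int.
  by rewrite sumrB -!expand addrC subrK.
rewrite xE; elim/big_rec: _ => [|i v _ Lv]; first by rewrite addr0.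
have [Ii|nIi] := boolP (I i); last by rewrite (H i nIi) subrr scale0r add0r.
by rewrite addrCA addrC; exact: step.
Qed.

Section Coords.
Variables (A : pset R m) (z0 : 'rV[int]_m) (I : pred 'I_m) (e cc : 'I_m -> 'rV[int]_m).
Hypothesis LC : lattice_coords A z0 I e cc.

Lemma lc_dot a x : A x ->
  dot a x = dot a (ipt z0) + \sum_(i | I i) (idot (cc i) x - (zdot (cc i) z0)%:~R) * dot a (ipt (e i)).
Proof.
move=> /(lc_mem LC) Ax.
have xE : x = ipt z0 + \sum_i (idot (cc i) x - (zdot (cc i) z0)%:~R) *: ipt (e i).
  under eq_bigr do rewrite scalerBl -idot_int.
  by rewrite sumrB -!(lc_expand LC) addrC subrK.
rewrite {1}xE dotDr dot_sumr [X in _ + X](bigID I) /= [X in _ + (_ + X)]big1 ?addr0 //.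
by move=> i /Ax ->; rewrite subrr mul0r.
Qed.

Lemma lc_affine : affine A.
Proof.
move=> x p q t /(lc_mem LC) Ax /(lc_mem LC) Ap /(lc_mem LC) Aq; apply/(lc_mem LC) => i Ii.
by rewrite /idot dot_line -!/(idot _ _) Ax // Ap // Aq // subrr mulr0 addr0.
Qed.

Lemma lc_z0 : A (ipt z0).
Proof. by apply/(lc_mem LC) => i _; rewrite idot_int. Qed.

Lemma lc_idot_e i j : idot (cc i) (ipt (e j)) = (i == j)%:R :> R.
Proof. by rewrite idot_int (lc_dual LC); case: (i == j). Qed.

Lemma lc_dir x t i : A x -> I i -> A (x + t *: ipt (e i)).
Proof.
move=> /(lc_mem LC) Ax Ii; apply/(lc_mem LC) => j nIj.
rewrite /idot dotDr dotZr -!/(idot _ _) lc_idot_e Ax //.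
by case: eqVneq => [ji|_]; [rewrite ji Ii in nIj|rewrite mulr0 addr0].
Qed.

Lemma lc_nonconstP a : nonconst A a <-> exists2 i, I i & dot a (ipt (e i)) != 0.
Proof.
split=> [[x [y [Ax [Ay xy]]]]|[i Ii ai]].
  apply: contrapT => n; apply: xy.
  have a0 i : I i -> dot a (ipt (e i)) = 0.
    by move=> Ii; apply: contrapT => /eqP h; apply: n; exists i.
  by rewrite (lc_dot a Ax) (lc_dot a Ay) !big1 // => i /a0 ->; rewrite mulr0.
exists (ipt z0), (ipt z0 + 1 *: ipt (e i)); split; first exact: lc_z0.
split; first by apply: lc_dir => //; exact: lc_z0.
by rewrite scale1r dotDr => /eqP; rewrite -subr_eq0 opprD addrA subrr add0r oppr_eq0 (negPf ai).
Qed.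

Lemma lc_int_span x : A x -> aff (fun z => A z /\ is_int_pt z) x.
Proof.
move=> /(lc_mem LC) Ax.
have xE : x = ipt z0 + \sum_i (idot (cc i) x - (zdot (cc i) z0)%:~R) *: ipt (e i).
  under eq_bigr do rewrite scalerBl -idot_int.
  by rewrite sumrB -!(lc_expand LC) addrC subrK.
have z0A : A (ipt z0) /\ is_int_pt (ipt z0) by split; [exact: lc_z0|exists z0].
rewrite xE; elim/big_rec: _ => [|i v _ Lv]; first by rewrite addr0; exact: sub_aff.
have [Ii|nIi] := boolP (I i); last by rewrite (Ax i nIi) subrr scale0r add0r.
rewrite addrCA addrC; set t := _ - _.
have -> : ipt (e i) = (ipt z0 + 1 *: ipt (e i)) - ipt z0 by rewrite scale1r addrC addKr.
apply: aff_affine => //; apply: sub_aff => //; split.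
  by apply: lc_dir => //; exact: lc_z0.
by rewrite scale1r; apply: int_ptD; [exists z0|exists (e i)].
Qed.

(** The affine function equal to 0 and 1 on the two hyperplanes is integral at the integer points of
    [A]. Its slopes along the basis are therefore integers and define an integral form. *)
Lemma split_within_normalize a b1 b2 : split_within A a b1 b2 ->
  exists (pi : 'rV[int]_m) (pi0 : int), nonconst A (ipt pi) /\
    forall x, A x -> idot pi x = pi0%:~R + (dot a x - b1) / (b2 - b1).
Proof.
move=> [ar [anc [b12 [[z1 [Az1 [z1i z1b]]] [[z2 [Az2 [z2i z2b]]] nosb]]]]].
have D0 : b2 - b1 != 0 by rewrite subr_eq0; apply/eqP => h; exact: b12.
pose phi x := (dot a x - b1) / (b2 - b1).
have phiE x : dot a x = b1 + phi x * (b2 - b1) by rewrite /phi divfK // addrC subrK.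
have phiint z : A z -> is_int_pt z -> exists k : int, phi z = k%:~R.
  move=> Az zi; exists (Num.floor (phi z)).
  have /andP[] := floor_itv (phi z); rewrite intrD.
  set k := Num.floor _ => k1 k2.
  (* Subtracting the integer part of [phi z] leaves an integer point strictly inside the split
     unless the fractional part is 0. *)
  pose w := z + (- k)%:~R *: (z2 - z1).
  have Aw : A w by exact: lc_affine.
  have wi : is_int_pt w by apply: int_ptD => //; apply: int_ptZ; exact: int_ptB.
  have wb : dot a w = b1 + (phi z - k%:~R) * (b2 - b1).
    by rewrite dot_line z1b z2b phiE mulrNz; ring.
  apply: contrapT => /eqP pk; apply: (nosb w Aw wi); rewrite wb /sbetween.
  have pk' : 0 < phi z - k%:~R by rewrite subr_gt0 lt_neqAle eq_sym pk.
  have pk'' : phi z - k%:~R < 1 by rewrite ltrBlDl.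
  move: (phi z - _) pk' pk'' => f f0 f1.
  have [h|h|h] := ltgtP b1 b2; last by case: b12.
    by left; apply/andP; split; nra.
  by right; apply/andP; split; nra.
have : forall i, exists n : int, I i -> dot a (ipt (e i)) / (b2 - b1) = n%:~R.
  move=> i; have [Ii|_] := boolP (I i); last by exists 0.
  have [k1 k1E] := phiint _ lc_z0 (ex_intro _ z0 erefl).
  have Ae := lc_dir 1 lc_z0 Ii; rewrite scale1r in Ae.
  have [|k2 k2E] := phiint _ Ae; first by apply: int_ptD; [exists z0|exists (e i)].
  exists (k2 - k1) => _; rewrite rmorphB /= -k1E -k2E /phi dotDr.
  by rewrite -mulrBl; congr (_ / _); ring.
move=> /fin_all_exists [n nE].
pose pi := \sum_(i | I i) n i *: cc i.
have piE x : idot pi x = \sum_(i | I i) (n i)%:~R * idot (cc i) x.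
  rewrite /pi; elim/big_rec2: _ => [|i y v _ <-]; first exact: idot0.
  by rewrite idotD idotZ.
have [k0 k0E] := phiint _ lc_z0 (ex_intro _ z0 erefl).
have phipi x : A x -> idot pi x = (zdot pi z0 - k0)%:~R + phi x.
  move=> Ax; rewrite rmorphB /= -idot_int -k0E /phi (lc_dot a Ax) !piE.
  have -> : \sum_(i | I i) (idot (cc i) x - (zdot (cc i) z0)%:~R) * dot a (ipt (e i)) =
     (\sum_(i | I i) (n i)%:~R * idot (cc i) x -
      \sum_(i | I i) (n i)%:~R * idot (cc i) (ipt z0)) * (b2 - b1).
    rewrite -sumrB mulr_suml; apply: eq_bigr => i Ii.
    by rewrite -(nE i Ii) idot_int -mulrBr mulrC mulrAC divfK.
  move: (\sum_(i | I i) _) (\sum_(i | I i) _) (dot a (ipt z0)) => S1 S2 d0.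
  by field.
exists pi, (zdot pi z0 - k0); split=> //.
have [x [y [Ax [Ay xy]]]] := anc; exists x, y; split=> //; split=> // h; apply: xy.
move: h; rewrite -!/(idot _ _) !phipi // => /addrI h.
by rewrite !phiE h.
Qed.

Definition box (N : int) : seq (constr m) :=
  flatten [seq [:: (cc i, zdot (cc i) z0 + N); (- cc i, N - zdot (cc i) z0)] | i <- enum I].

Lemma mem_box N c : c \in box N -> exists2 i, I i &
  c = (cc i, zdot (cc i) z0 + N) \/ c = (- cc i, N - zdot (cc i) z0).
Proof.
move=> /flattenP [l /mapP [i + ->]]; rewrite mem_enum => Ii.
by rewrite !in_cons in_nil orbF => /orP[/eqP|/eqP] ->; exists i => //; [left|right].
Qed.

Lemma sat_box N x : sat (box N) x <->
  forall i, I i -> `|idot (cc i) x - (zdot (cc i) z0)%:~R| <= N%:~R.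
Proof.
split=> [H i Ii|H c /mem_box [i Ii [->|->]]] /=; last 2 first.
- by have := H i Ii; rewrite ler_norml rmorphD /= => /andP[_]; rewrite lerBlDl.
- have := H i Ii; rewrite ler_norml rmorphB /= idotN => /andP[+ _]; lra.
have iE : [:: (cc i, zdot (cc i) z0 + N); (- cc i, N - zdot (cc i) z0)] \in
   [seq [:: (cc i, zdot (cc i) z0 + N); (- cc i, N - zdot (cc i) z0)] | i <- enum I].
  by apply: (map_f (fun i => [:: (cc i, zdot (cc i) z0 + N); (- cc i, N - zdot (cc i) z0)]));
   rewrite mem_enum.
have /H h1 : (cc i, zdot (cc i) z0 + N) \in box N.
  by apply/flattenP; eexists; [exact: iE|rewrite mem_head].
have /H h2 : (- cc i, N - zdot (cc i) z0) \in box N.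
  by apply/flattenP; eexists; [exact: iE|rewrite !in_cons eqxx orbT].
move: h1 h2; rewrite /= rmorphB rmorphD /= idotN ler_norml; lra.
Qed.

Lemma box_nonconst N c : c \in box N -> nonconst A (ipt c.1).
Proof.
move=> /mem_box [i Ii [->|->]]; apply/lc_nonconstP; exists i => //.
  by rewrite -/(idot _ _) lc_idot_e eqxx oner_eq0.
by rewrite -/(idot _ _) idotN lc_idot_e eqxx oppr_eq0 oner_eq0.
Qed.

Lemma box_int_pt N c : c \in box N ->
  exists z, A z /\ is_int_pt z /\ ival c z = ibound R c.
Proof.
have ip k i : is_int_pt (ipt z0 + (k%:~R : R) *: ipt (e i)).
  by apply: int_ptD; [exists z0|apply: int_ptZ; exists (e i)].
move=> /mem_box [i Ii [->|->]].
  exists (ipt z0 + N%:~R *: ipt (e i)); split; first by apply: lc_dir => //; exact: lc_z0.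
  split=> //; rewrite /ival /ibound /= /idot dotDr dotZr -!/(idot _ _) lc_idot_e.
  by rewrite eqxx mulr1 idot_int rmorphD.
exists (ipt z0 + (- N)%:~R *: ipt (e i)); split; first by apply: lc_dir => //; exact: lc_z0.
split=> //; rewrite /ival /ibound /= idotN /idot dotDr dotZr -!/(idot _ _) lc_idot_e.
by rewrite eqxx mulr1 idot_int rmorphB /= mulrNz; ring.
Qed.

(** The cross-polytope with vertices [z0 + m N e_i] and [z0 - m N e_i] contains the box and has
    explicit integral generators. Cutting it by the box and by [s] gives a rational polytope.
    Indices outside [I] only repeat the vertex [z0]. *)
Lemma box_polytope N i0 s : 0 < N -> I i0 -> rat_polytope (hpoly A (box N ++ s)).
Proof.
move=> N0 Ii0.
have m0 : 0 < m%:R :> R by rewrite ltr0n; exact: leq_ltn_trans (ltn_ord i0).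
have N0' : 0 < N%:~R :> R by rewrite ltr0z.
pose sg (b : bool) : int := if b then 1 else -1.
pose P (k : 'I_m * bool) : point R m :=
  ipt z0 + (sg k.2 * m%:R * N * (I k.1)%:R)%:~R *: ipt (e k.1).
have AP k : A (P k).
  rewrite /P; have [Ik|_] := boolP (I k.1); first by apply: lc_dir => //; exact: lc_z0.
  by rewrite mulr0 scale0r addr0; exact: lc_z0.
pose Q : pset R m := conv (fun y => y \in codom P).
have Qr : rat_polytope Q.
  apply/rat_polytopeP; exists (codom P); split=> // _ /codomP [k ->].
  by apply: is_int_rat; apply: int_ptD; [exists z0|apply: int_ptZ; exists (e k.1)].
have QA x : Q x -> A x.
  move=> [n [p [w [pP [_ [w1 xE]]]]]]; apply: (affine_sum lc_affine).
  by exists n, p, w; split=> // i; have /codomP [k ->] := pP i.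
have boxQ x : A x -> sat (box N) x -> Q x.
  move=> Ax /sat_box xN; pose y i := idot (cc i) x - (zdot (cc i) z0)%:~R.
  have y0 i : ~~ I i -> y i = 0 by move=> nI; rewrite /y ((proj1 (lc_mem LC x)) Ax) // subrr.
  have yN i : `|y i| <= N%:~R.
    by have [Ii|/y0 ->] := boolP (I i); [exact: xN|rewrite normr0 ltW].
  (* Each index receives mass [1/m], divided between its two signs so that the difference produces
     the coordinate [y i]. *)
  pose w (k : 'I_m * bool) : R := (1 + (sg k.2)%:~R * (y k.1 / N%:~R)) / (2 * m%:R).
  have wS i : w (i, true) + w (i, false) = m%:R^-1.
    by rewrite /w /= mulrNz; field; rewrite !gt_eqF.
  have -> : x = \sum_k w k *: P k.
    transitivity (\sum_i \sum_b w (i, b) *: P (i, b)); last by rewrite pair_bigA; apply: eq_bigr => -[].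
    have row i : \sum_b w (i, b) *: P (i, b) = m%:R^-1 *: ipt z0 + y i *: ipt (e i).
      rewrite big_bool /= /P /= !scalerDr addrACA -scalerDl wS !scalerA -scalerDl.
      congr (_ + _ *: _); have [Ii|/y0 yi] := boolP (I i); last first.
        by rewrite yi !mulr0 addr0.
      rewrite !mulr1 !rmorphM /= /w /= mulrNz /= -!pmulrn.
      by field; rewrite !gt_eqF.
    under eq_bigr do rewrite row.
    rewrite big_split /= sumr_const card_ord -scaler_nat scalerA divff ?gt_eqF // scale1r.
    under eq_bigr do rewrite scalerBl -idot_int.
    by rewrite sumrB -!(lc_expand LC) addrC subrK.
  apply: conv_fin.
  - by move=> k _; exact: codom_f.
  - move=> [i b]; rewrite /w; apply: divr_ge0; last by rewrite mulr_ge0 // ltW.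
    have : `|y i / N%:~R| <= 1 by rewrite normrM normfV (gtr0_norm N0') ler_pdivrMr // mul1r.
    move: (y i / _) => r; rewrite ler_norml => /andP[h1 h2].
    case: b => /=; [rewrite mulr1z mul1r|rewrite mulrN1z mulN1r]; lra.
  transitivity (\sum_i \sum_b w (i, b)); first by rewrite pair_bigA; apply: eq_bigr => -[].
  under eq_bigr do rewrite big_bool /= wS.
  by rewrite sumr_const card_ord -[LHS]mulr_natr mulVf // gt_eqF.
have [n [q [qr qE]]] := rat_polytope_cuts (box N ++ s) Qr.
exists n, q; split=> // x; rewrite -qE; split=> -[hx sx]; split=> //; last exact: QA.
by apply: boxQ => // c cb; apply: sx; rewrite mem_cat cb.
Qed.

Lemma coord_bound (V : seq (point R m)) : exists N : int, 0 < N /\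
  forall q i, q \in V -> `|idot (cc i) q - (zdot (cc i) z0)%:~R| <= N%:~R.
Proof.
elim: V => [|q V [N [N0 HN]]]; first by exists 1.
pose b := \sum_i `|idot (cc i) q - (zdot (cc i) z0)%:~R|.
have b0 : 0 <= b by apply: sumr_ge0.
exists (N + (Num.bound b)%:Z); split; first by rewrite ltr_wpDr.
move=> p i; rewrite in_cons rmorphD /= => /orP[/eqP ->|pV].
  apply: le_trans (_ : b <= _).
    by rewrite /b (bigD1 i) //= lerDl sumr_ge0.
  by apply: le_trans (ltW (archi_boundP b0)) _; rewrite lerDr ler0z ltW.
by apply: le_trans (HN p i pV) _; rewrite lerDl ler0z.
Qed.

(* If no integer point of A lies on the hyperplane [c], then
   [M c + cc i2 <= M b + T] separates the same integer points of the box, and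
   the Bezout relation [u * M a1 + v * (M a2 + 1) = 1] with [M = 2 T a1^2],
   [u = 2 T a1 a2^2], [v = 1 - M a2] makes its hyperplane contain an integer point. *)
Lemma perturb_constr (c : constr m) N i2 j2 : 0 < N -> I i2 -> I j2 -> i2 != j2 ->
  nonconst A (ipt c.1) -> exists c' : constr m,
  [/\ nonconst A (ipt c'.1), exists z, A z /\ is_int_pt z /\ ival c' z = ibound R c',
   forall x, sat (box N) x -> ival c x <= ibound R c -> ival c' x <= ibound R c' &
   forall x, A x -> sat (box N) x -> is_int_pt x ->
     (ival c' x <= ibound R c' -> ival c x <= ibound R c) /\
     (ival c x <= ibound R c -> ival c' x = ibound R c' <-> ival c x = ibound R c)].
Proof.
move=> N0 Ii2 Ij2 ij nc.
have [att|natt] := pselect (exists z, A z /\ is_int_pt z /\ ival c z = ibound R c).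
  by exists c; split.
have [i1 Ii1] := (proj1 (lc_nonconstP _)) nc; rewrite -/(idot _ _) idot_int intr_eq0.
set a1 := zdot _ _ => a1n.
(* The tilt must use a coordinate other than [i1], so that the coefficient along [e i1] stays
   exactly [M * a1], as the Bezout relation requires. *)
have [k [Ik ki1]] : exists k, I k /\ k != i1.
  by have [h|h] := eqVneq i2 i1; [exists j2; rewrite -h eq_sym|exists i2].
pose a2 := zdot c.1 (e k).
(* The extra 1 makes the bound on [cc k] strict in the box, so a point of the box satisfying [c] is
   never tight on [c']. *)
pose T : int := `|zdot (cc k) z0| + N + 1.
have T0 : 0 < T by rewrite /T; have := normr_ge0 (zdot (cc k) z0); lra.
pose M : int := a1 ^+ 2 * (2 * T).
have M2T : 2 * T <= M.
  have a1p : 0 < a1 ^+ 2 by rewrite exprn_even_gt0.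
  by rewrite /M; move: (a1 ^+ 2) a1p => q q0; nia.
have T0' : 0 < T%:~R :> R by rewrite ltr0z.
have M2T' : 2 * T%:~R <= M%:~R :> R by rewrite -[2]/((2 : int)%:~R) -rmorphM /= ler_int.
have ccT x : sat (box N) x -> `|idot (cc k) x| < T%:~R.
  move=> /sat_box /(_ k Ik) h; rewrite /T !rmorphD /= intr_norm.
  have := ler_normD (idot (cc k) x - (zdot (cc k) z0)%:~R) (zdot (cc k) z0)%:~R.
  by rewrite subrK; lra.
pose c' : constr m := (M *: c.1 + cc k, M * c.2 + T).
have c'x x : ival c' x = M%:~R * ival c x + idot (cc k) x.
  by rewrite /ival /= idotD idotZ.
have c'b : ibound R c' = M%:~R * ibound R c + T%:~R by rewrite /ibound /= rmorphD rmorphM.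
have zc' i : zdot c'.1 (e i) = M * zdot c.1 (e i) + (k == i)%:R.
  apply/eqP; rewrite -(eqr_int R) -idot_int -/(ival c' _) c'x lc_idot_e.
  by rewrite /ival idot_int rmorphD rmorphM /= natz -pmulrn.
have stay x : sat (box N) x -> ival c x <= ibound R c -> ival c' x < ibound R c'.
  move=> /ccT; rewrite c'x c'b ltr_norml => /andP[_ h] h'.
  by apply: ler_ltD => //; rewrite ler_wpM2l //; lra.
exists c'; split.
- apply/lc_nonconstP; exists i1 => //.
  rewrite -/(idot _ _) idot_int intr_eq0 zc' (negPf ki1) addr0 mulf_neq0 // gt_eqF //.
  by apply: lt_le_trans M2T; rewrite mulr_gt0.
(* [h] is the amount by which [z0] misses the new hyperplane; [h] times the Bezout relation corrects
   it. *)
- pose u := 2 * T * a1 * a2 ^+ 2; pose v := 1 - M * a2.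
  pose h := c'.2 - zdot c'.1 z0.
  exists (ipt z0 + (h * u)%:~R *: ipt (e i1) + (h * v)%:~R *: ipt (e k)); split.
    by apply: lc_dir => //; apply: lc_dir => //; exact: lc_z0.
  split.
    by apply: int_ptD; [apply: int_ptD; [exists z0|]|]; try apply: int_ptZ; eexists.
  rewrite /ival /ibound /idot !dotDr !dotZr -!/(idot _ _) !idot_int !zc' eqxx (negPf ki1).
  have bez : u * (M * a1 + 0) + v * (M * a2 + 1) = 1 by rewrite /u /v /M; ring.
  rewrite -!rmorphM -!rmorphD /= -/a1 -/a2; congr (_%:~R).
  transitivity (zdot c'.1 z0 + h * (u * (M * a1 + 0) + v * (M * a2 + 1))).
    by rewrite /=; ring.
  by rewrite bez mulr1 /h addrC subrK.
- by move=> x xb xc; apply: ltW; exact: stay.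
move=> x Ax xb xi; split=> [h|xc].
  have [w xE] := xi; rewrite leNgt; apply/negP => h'.
  (* By integrality [c] is violated by at least 1, hence by at least [M >= 2 T] after scaling. In
     the box [cc k] exceeds [- T], so [c'] is violated as well. *)
  have : ibound R c + 1 <= ival c x.
    move: h'; rewrite xE /ival /ibound idot_int ltr_int -lezD1 => h'.
    by rewrite -[1]/((1 : int)%:~R) -rmorphD ler_int.
  move=> h''; have := ccT x xb; rewrite ltr_norml => /andP[h1 h2].
  have : M%:~R * (ibound R c + 1) <= M%:~R * ival c x by rewrite ler_wpM2l //; lra.
  by move: h; rewrite c'x c'b mulrDr mulr1; lra.
by split=> h; [have := stay x xb xc; rewrite h ltxx|case: natt; exists x].
Qed.

(** On a line a lattice-free segment fits between two consecutive lattice points. This covers the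
    dimension in which no second coordinate is available for a tilt. *)
Lemma one_dim_slab s i1 : let K := hpoly A s in I i1 -> (forall i, I i -> i = i1) ->
  (forall x, A x -> aff K x) -> (forall c, c \in s -> nonconst A (ipt c.1)) ->
  (exists x, K x) -> lattice_free K ->
  exists a b1 b2, split_within A a b1 b2 /\ forall x, K x -> between b1 (dot a x) b2.
Proof.
move=> K Ii1 I1 Kf snc [u0 Ku0] lf.
pose f x : R := idot (cc i1) x.
have fnc : nonconst A (ipt (cc i1)).
  by apply/lc_nonconstP; exists i1 => //; rewrite -/(idot _ _) lc_idot_e eqxx oner_eq0.
have expand a x : A x -> dot a x = dot a (ipt z0) + (f x - (zdot (cc i1) z0)%:~R) * dot a (ipt (e i1)).
  move=> Ax; rewrite (lc_dot a Ax) (bigD1 i1) //= big1 ?addr0 // => i /andP[/I1 -> ].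
  by rewrite eqxx.
pose lat (n : int) : point R m := ipt z0 + (n - zdot (cc i1) z0)%:~R *: ipt (e i1).
have lati n : is_int_pt (lat n) by apply: int_ptD; [exists z0|apply: int_ptZ; exists (e i1)].
have Alat n : A (lat n) by apply: lc_dir => //; exact: lc_z0.
have flat n : f (lat n) = n%:~R.
  rewrite /f /lat /idot dotDr dotZr -!/(idot _ _) lc_idot_e eqxx mulr1 idot_int.
  by rewrite rmorphB /= addrC subrK.
(* Every inequality is strictly monotone along the line, so a lattice point strictly between two
   points of [K] is strict for all of them. *)
have noint u v (n : int) : K u -> K v -> f u < n%:~R -> n%:~R < f v -> False.
  move=> Ku Kv un nv; apply: (lf (lat n)) => //.
  apply: (strict_relint lc_affine Kf) => // d ds.
  have [i /I1 ->] := (proj1 (lc_nonconstP _)) (snc d ds).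
  have := Ku.2 d ds; have := Kv.2 d ds; rewrite -!/(ival _ _) -!/(ibound R d).
  rewrite /ival /idot (expand _ u) ?(expand _ v) ?(expand _ (lat n)) ?flat //; [|by case: Kv|by case: Ku].
  move: (dot _ (ipt z0)) (dot _ (ipt (e i1))) (ibound R d) ((zdot (cc i1) z0)%:~R : R) => p q r t h1 h2 q0.
  have [qp|qn|q00] := ltgtP 0 q; last by rewrite -q00 eqxx in q0.
    by apply: lt_le_trans h1; rewrite ltrD2l ltr_pM2r // ltrD2r.
  by apply: lt_le_trans h2; rewrite ltrD2l ltr_nM2r // ltrD2r.
have [u [v [Ku Kv uv]]] : exists u v, [/\ K u, K v & f u < f v].
  have [v Kv] := full_nonconst Kf (f u0) fnc.
  by rewrite neq_lt => /orP[h|h]; [exists v, u0|exists u0, v].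
pose k := Num.floor (f u).
have /andP[k1 k2] : k%:~R <= f u < (k + 1)%:~R := floor_itv (f u).
exists (ipt (cc i1)), k%:~R, (k + 1)%:~R; split.
  split; first by apply: is_int_rat; exists (cc i1).
  split=> //; split; first by rewrite rmorphD /= => h; lra.
  split; first by exists (lat k).
  split; first by exists (lat (k + 1)).
  move=> _ _ [w ->]; rewrite -/(idot _ _) idot_int /sbetween !ltr_int ltzD1.
  by case=> /andP[h1 h2]; lia.
move=> x Kx; left; rewrite -/(idot _ _) -/(f x); apply/andP; split.
  rewrite leNgt; apply/negP => xk; have [uk|uk] := ltP k%:~R (f u).
    exact: noint Kx Ku xk uk.
  (* Here [f u] is the integer [k] itself, and the second point [v] is needed to have [k] strictly
     inside. *)
  by apply: (noint _ _ _ Kx Kv xk); exact: le_lt_trans uv.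
by rewrite leNgt; apply/negP => xk; exact: noint Ku Kx k2 xk.
Qed.

End Coords.
End Lattice.

(** * The enlarged polytope in the two cases *)

Section Enlargement.
Variables (R : realType) (m : nat).
Implicit Types (x y z a : point R m).

Local Notation ipt := (map_mx (intr : int -> R)).

Definition has_enlargement (L : pset R m) : Prop :=
  exists L' : pset R m,
    rat_polytope L' /\
    (forall x, L x -> L' x) /\
    (forall x, L' x -> aff L x) /\
    lattice_free L' /\
    (two_hyperplane_property L <-> two_hyperplane_property L') /\
    (forall F, facet L' F ->
       (exists z, aff F z /\ is_int_pt z) /\
       (exists a b1 b2, facet_split (aff L) L' F a b1 b2) /\
       (forall a b1 b2, facet_split (aff L) L' F a b1 b2 ->
          split_intersecting L' a b1 b2)).

Lemma hpoly_of_polytope (A L : pset R m) s (z0 : 'rV[int]_m) I e cc :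
  lattice_coords A z0 I e cc -> (forall x, L x <-> sat s x) -> (forall x, L x -> A x) ->
  (exists x, L x) ->
  exists s', (forall x, L x <-> hpoly A s' x) /\
    (forall c, c \in s' -> nonconst A (ipt c.1)).
Proof.
move=> LC Ls LA [x0 Lx0].
pose nc (c : constr m) := [exists i, I i && (zdot c.1 (e i) != 0)].
have ncP c : nc c <-> nonconst A (ipt c.1).
  rewrite (lc_nonconstP LC); split.
    by move=> /existsP [i /andP[Ii ci]]; exists i => //; rewrite -/(idot _ _) idot_int intr_eq0.
  move=> [i Ii]; rewrite -/(idot _ _) idot_int intr_eq0 => ci.
  by apply/existsP; exists i; rewrite Ii.
exists [seq c <- s | nc c]; split; last by move=> c; rewrite mem_filter => /andP[/ncP].
move=> x; split=> [Lx|[Ax sx]].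
  by split; [exact: LA|move=> c; rewrite mem_filter => /andP[_ cs]; exact: (proj1 (Ls x))].
apply/Ls => c cs; have [cn|cn] := boolP (nc c); first by apply: sx; rewrite mem_filter cn.
have -> : idot c.1 x = idot c.1 x0.
  apply: contrapT => h; case/negP: cn; apply/ncP; exists x, x0.
  by split=> //; split=> //; exact: LA.
exact: (proj1 (Ls x0)).
Qed.

(** The common end of both cases. The box bounds [L'] and its own hyperplanes contain integer
    points; lattice-freeness holds because each integer point of [L'] is tight on some inequality of
    [s]. *)
Lemma enlargement_sound (L : pset R m) (z0 : 'rV[int]_m) I e cc N i0 s :
  lattice_coords (aff L) z0 I e cc -> I i0 -> 0 < N ->
  let S := box z0 I cc N ++ s in let L' := hpoly (aff L) S in
  (forall x, L x -> sat S x) ->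
  (forall c, c \in s -> nonconst (aff L) (ipt c.1)) ->
  (forall c, c \in s -> exists z, aff L z /\ is_int_pt z /\ ival c z = ibound R c) ->
  (forall a b1 b2, split_within (aff L) a b1 b2 -> ~ in_half_open_slab L' a b1 b2) ->
  (forall z, is_int_pt z -> L' z -> exists2 c, c \in s & ival c z = ibound R c) ->
  (two_hyperplane_property L <-> two_hyperplane_property L') ->
  has_enlargement L.
Proof.
move=> LC Ii0 N0 S L' LS snc satt thick lf iff2.
have LL' x : L x -> L' x by move=> Lx; split; [exact: sub_aff|exact: LS].
have Aa := lc_affine LC.
have full x : aff L x -> aff L' x by exact: aff_sub.
have Snc c : c \in S -> nonconst (aff L) (ipt c.1).
  by rewrite mem_cat => /orP[/(box_nonconst LC)|/snc].
have Satt c : c \in S -> exists z, aff L z /\ is_int_pt z /\ ival c z = ibound R c.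
  by rewrite mem_cat => /orP[/(box_int_pt LC)|/satt].
exists L'; split; first exact: box_polytope LC _ _ _ N0 Ii0.
split=> //; split; first by move=> x [].
split.
  move=> z zi rz; have [c cs zc] := lf z zi (proj1 rz).
  have := relint_strict Aa full Snc rz.
  by move=> /(_ c); rewrite mem_cat cs orbT => /(_ isT); rewrite zc ltxx.
split=> // F Ff; split; first exact: facet_int_pt Aa full Snc Satt _ Ff.
split; first exact: facet_split_exists Aa full Snc (lc_int_span LC) Satt _ Ff.
by move=> a b1 b2; exact: facet_split_intersecting Aa full Snc Satt thick _ _ _ _ Ff.
Qed.

(** The bound is strict so that no point of [L] touches a hyperplane of the box. [V] collects
    further points the box must contain. *)
Lemma polytope_coord_bound (L : pset R m) (V : seq (point R m)) (z0 : 'rV[int]_m) (cc : 'I_m -> 'rV[int]_m) :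
  rat_polytope L -> exists N : int, 0 < N /\
  (forall x i, L x -> `|idot (cc i) x - (zdot (cc i) z0)%:~R| < N%:~R) /\
  (forall x i, x \in V -> `|idot (cc i) x - (zdot (cc i) z0)%:~R| < N%:~R).
Proof.
move=> /rat_polytopeP [W [_ LE]].
have [N [N0 HN]] := coord_bound z0 cc (W ++ V).
exists (N + 1); split; first by rewrite addr_gt0.
have lt1 r : r <= N%:~R -> r < (N + 1)%:~R :> R.
  by move=> h; apply: le_lt_trans h _; rewrite ltr_int ltrDl.
split=> x i xV; last by apply: lt1; apply: HN; rewrite mem_cat xV orbT.
apply: lt1; rewrite ler_norml; apply/andP; split.
  have : dot (ipt (- cc i)) x <= N%:~R - (zdot (cc i) z0)%:~R.
    move/LE: xV; apply: conv_le => q qW; rewrite -/(idot _ _) idotN.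
    by have := HN q i; rewrite mem_cat qW ler_norml => /(_ isT) /andP[]; lra.
  by rewrite -/(idot _ _) idotN; lra.
have : dot (ipt (cc i)) x <= N%:~R + (zdot (cc i) z0)%:~R.
  move/LE: xV; apply: conv_le => q qW; rewrite -/(idot _ _).
  by have := HN q i; rewrite mem_cat qW ler_norml => /(_ isT) /andP[]; lra.
by rewrite -/(idot _ _); lra.
Qed.

Lemma half_open_int_level (A K : pset R m) a b1 b2 z : split_within A a b1 b2 ->
  in_half_open_slab K a b1 b2 -> A z -> is_int_pt z -> K z -> dot a z = b1.
Proof.
move=> [_ [_ [_ [_ [_ nosb]]]]] H Az zi Kz; have [bt zb2] := H z Kz.
have ns := nosb z Az zi; apply: contrapT => zb1; apply: ns.
have n1 : dot a z != b1 by exact/eqP.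
have n2 : dot a z != b2 by exact/eqP.
by case: bt => /andP[h1 h2]; [left|right]; rewrite !lt_neqAle h1 h2 ?n1 ?n2 ?(eq_sym b1) ?(eq_sym b2) ?n1 ?n2.
Qed.

Lemma seq_rel_choice (T : eqType) (P : T -> T -> Prop) (s : seq T) :
  (forall c, c \in s -> exists c', P c c') ->
  exists s' : seq T, (forall c, c \in s -> exists2 c', c' \in s' & P c c') /\
    (forall c', c' \in s' -> exists2 c, c \in s & P c c').
Proof.
elim: s => [|c s IH] H; first by exists [::].
have [|s' [h1 h2]] := IH; first by move=> d ds; apply: H; rewrite in_cons ds orbT.
have [c' cc'] := H c (mem_head _ _).
exists (c' :: s'); split=> d; rewrite in_cons => /orP[/eqP ->|].
- by exists c' => //; exact: mem_head.
- by move=> /h1 [d' d's' dd']; exists d' => //; rewrite in_cons d's' orbT.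
- by exists c => //; exact: mem_head.
- by move=> /h2 [d' d's' dd']; exists d' => //; rewrite in_cons d's' orbT.
Qed.

(** Used in both directions. Equal integer points give equal integer hulls. A face inside a facet of
    [L'] is tight on one inequality there, hence on one of [L], and so lies in a facet of [L]. The
    tight point [g] is what rules out inequalities of the box. *)
Lemma two_hyperplane_transfer (A L L' : pset R m) s s' :
  L = hpoly A s -> L' = hpoly A s' ->
  affine A -> (forall x, A x -> aff L x) ->
  (forall c, c \in s -> nonconst A (ipt c.1)) ->
  (forall z, is_int_pt z -> L z <-> L' z) ->
  (forall c' g, c' \in s' -> L g -> is_int_pt g -> ival c' g = ibound R c' ->
     exists2 c, c \in s & forall z, L z -> is_int_pt z ->
       ival c' z = ibound R c' -> ival c z = ibound R c) ->
  two_hyperplane_property L' -> two_hyperplane_property L.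
Proof.
move=> LE L'E Aa full snc same tr H G GL nGF.
have [[g [Gg gi]]|nG] := pselect (exists g, G g /\ is_int_pt g); last first.
  by left=> x y h; case: nG; exists x.
have hullE : int_hull L' = int_hull L.
  congr conv; apply/funext => x; apply/propext.
  by split=> -[h xi]; split=> //; apply/(same x xi).
apply: H; first by rewrite hullE.
move=> [F' [F'f GF']]; apply: nGF.
have GL1 x : G x -> L x.
  by case: GL => [a [b [_ GE]]] /GE [+ _]; rewrite LE; exact: int_hull_sub.
rewrite L'E in F'f; have [c' c's' F'c'] := facet_constr Aa F'f.
have [c cs ctr] := tr c' g c's' (GL1 g Gg) gi (F'c' g (GF' g Gg)).
have Gc z : G z -> is_int_pt z -> dot (ipt c.1) z = ibound R c.
  by move=> Gz zi; apply: ctr => //; [exact: GL1|exact: F'c' (GF' z Gz)].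
have full1 x : A x -> aff (hpoly A s) x by rewrite -LE; exact: full.
have [y Ky yc] := full_strict1 full1 snc cs.
have le x : hpoly A s x -> dot (ipt c.1) x <= ibound R c by move=> [_]; exact.
have := GL1 g Gg; rewrite LE => Kg.
have [F Ff FG] := exposed_facet Aa full1 snc le Kg (Gc g Gg gi) Ky yc.
exists F; split=> // x Gx; apply: FG; first by rewrite -LE; exact: GL1.
exact: (face_int_hull_level GL Gc).
Qed.

Section Cases.
Variables (L : pset R m) (z0 : 'rV[int]_m) (I : pred 'I_m) (e cc : 'I_m -> 'rV[int]_m).
Variables (i0 : 'I_m) (s : seq (constr m)).
Hypothesis Lr : rat_polytope L.
Hypothesis LC : lattice_coords (aff L) z0 I e cc.
Hypothesis Ii0 : I i0.
Hypothesis LE : L = hpoly (aff L) s.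
Hypothesis full : forall x, aff L x -> aff (hpoly (aff L) s) x.
Hypothesis snc : forall c, c \in s -> nonconst (aff L) (ipt c.1).

Let Aa := lc_affine LC.

(* Both L and the slab cut by a large box have the 2-hyperplane property. *)
Lemma slab_enlargement a b1 b2 : split_within (aff L) a b1 b2 ->
  (forall x, L x -> between b1 (dot a x) b2) -> has_enlargement L.
Proof.
move=> sw Lslab.
have [pi [pi0 [pinc piE]]] := split_within_normalize LC sw.
have [_ [_ [b12 [[z1 [Az1 [z1i z1b]]] [[z2 [Az2 [z2i z2b]]] _]]]]] := sw.
have D0 : b2 - b1 != 0 by rewrite subr_eq0; apply/eqP => h; exact: b12.
have slab x : L x -> pi0%:~R <= idot pi x <= (pi0 + 1)%:~R.
  move=> Lx; rewrite (piE x (sub_aff Lx)) rmorphD /= lerDl lerD2l.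
  have [h|h|h] := ltgtP b1 b2; last by case: b12.
    have Dp : 0 < b2 - b1 by rewrite subr_gt0.
    rewrite ler_pdivlMr // ler_pdivrMr // mul0r mul1r.
    by case: (Lslab x Lx) => /andP[? ?]; apply/andP; split; lra.
  have Dn : b2 - b1 < 0 by rewrite subr_lt0.
  rewrite ler_ndivlMr // ler_ndivrMr // mul0r mul1r.
  by case: (Lslab x Lx) => /andP[? ?]; apply/andP; split; lra.
have z1pi : idot pi z1 = pi0%:~R by rewrite piE // z1b subrr mul0r addr0.
have z2pi : idot pi z2 = (pi0 + 1)%:~R by rewrite piE // z2b divff // rmorphD.
(* [z1 + e i] is brought back to the level of [z1] by a multiple of [z2 - z1], on which [pi] has
   value 1. *)
pose p i := z1 + 1 *: ipt (e i) + (- zdot pi (e i))%:~R *: (z2 - z1).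
have pint i : is_int_pt (p i).
  apply: int_ptD; last by apply: int_ptZ; exact: int_ptB.
  by apply: int_ptD => //; rewrite scale1r; exists (e i).
have Ap i : I i -> aff L (p i).
  by move=> Ii; apply: Aa => //; exact: (lc_dir LC).
have ppi i : idot pi (p i) = pi0%:~R.
  rewrite /p /idot dot_line dotDr dotZr -!/(idot _ _) z1pi z2pi idot_int.
  by rewrite rmorphD /= mulrNz; ring.
have [N [N0 [LN pN]]] := polytope_coord_bound [:: z1, z2 & codom p] z0 cc Lr.
pose s2 : seq (constr m) := [:: (pi, pi0 + 1); (- pi, - pi0)].
have sat2 x : sat s2 x <-> pi0%:~R <= idot pi x <= (pi0 + 1)%:~R.
  split=> [H|/andP[h1 h2] c].
    have := H (pi, pi0 + 1) (mem_head _ _); have := H (- pi, - pi0).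
    rewrite !in_cons eqxx orbT => /(_ isT); rewrite /= idotN mulrNz lerN2.
    by move=> -> ->.
  rewrite !in_cons in_nil orbF => /orP[/eqP ->|/eqP ->] //=.
  by rewrite idotN mulrNz lerN2.
have s2nc c : c \in s2 -> nonconst (aff L) (ipt c.1).
  rewrite !in_cons in_nil orbF => /orP[/eqP ->|/eqP ->] //=.
  have [x [y [Ax [Ay xy]]]] := pinc; exists x, y; split=> //; split=> //.
  by rewrite -!/(idot _ _) !idotN => /oppr_inj.
have in_box x : (forall i, `|idot (cc i) x - (zdot (cc i) z0)%:~R| < N%:~R) ->
   sat (box z0 I cc N) x.
  by move=> h; apply/sat_box => i _; exact: ltW.
have satS x : sat (box z0 I cc N ++ s2) x <-> sat (box z0 I cc N) x /\ sat s2 x.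
  split=> [h|[h1 h2] c]; last by rewrite mem_cat => /orP[/h1|/h2].
  by split=> c cs; apply: h; rewrite mem_cat cs ?orbT.
have LS x : L x -> sat (box z0 I cc N ++ s2) x.
  move=> Lx; apply/satS; split; first by apply: in_box => i; exact: LN.
  by apply/sat2; exact: slab.
apply: (enlargement_sound LC Ii0 N0 LS s2nc).
- move=> c; rewrite !in_cons in_nil orbF => /orP[/eqP ->|/eqP ->].
    by exists z2.
  by exists z1; split=> //; split=> //; rewrite /ival /ibound /= idotN mulrNz z1pi.
(* The points [z1], [z2] and [p i] affinely span the hull. In a half-open slab they would all lie on
   the first hyperplane, making [a'] constant. *)
- move=> a' b1' b2' sw' H.
  have lev z : aff L z -> is_int_pt z -> z \in [:: z1, z2 & codom p] ->
     pi0%:~R <= idot pi z <= (pi0 + 1)%:~R -> dot a' z = b1'.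
    move=> Az zi zV zpi; apply: (half_open_int_level sw' H) => //; split=> //.
    by apply/satS; split; [apply: in_box => i; exact: pN|exact/sat2].
  have l01 : pi0%:~R <= (pi0 + 1)%:~R :> R by rewrite ler_int lerDl.
  have e1 : dot a' z1 = b1' by apply: lev; rewrite ?mem_head ?z1pi ?lexx.
  have e2 : dot a' z2 = b1' by apply: lev; rewrite ?in_cons ?eqxx ?orbT ?z2pi ?lexx ?andbT.
  have [_ [nc' _]] := sw'.
  have [i Ii] := (proj1 (lc_nonconstP LC _)) nc'; case/negP.
  have : dot a' (p i) = b1'.
    by apply: lev; rewrite ?ppi ?lexx //; [exact: Ap|rewrite !in_cons codom_f !orbT].
  rewrite /p dot_line e1 e2 subrr mulr0 addr0 dotDr e1 scale1r => /eqP.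
  by rewrite -subr_eq0 addrAC subrr add0r.
- move=> z zi [_ /satS [_ /sat2]]; have [w zE] := zi.
  rewrite zE idot_int !ler_int => /andP[h1 h2].
  have [h|h] := leP (zdot pi w) pi0.
    exists (- pi, - pi0); first by rewrite !in_cons eqxx orbT.
    rewrite /ival /ibound /= idotN idot_int mulrNz; congr (- _%:~R).
    by apply/le_anti; rewrite h h1.
  exists (pi, pi0 + 1); first exact: mem_head.
  by rewrite /ival /ibound /= idot_int; congr (_%:~R); apply/le_anti; rewrite h2 lezD1.
split=> _.
  have Snc c : c \in box z0 I cc N ++ s2 -> nonconst (aff L) (ipt c.1).
    by rewrite mem_cat => /orP[/(box_nonconst LC)|/s2nc].
  apply: (slab_two_hyperplane (pi0 := pi0) Aa _ Snc pinc) => [x|x [_ /satS [_ /sat2 //]]].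
  by apply: aff_sub => y Ly; split; [exact: sub_aff|exact: LS].
by rewrite LE; apply: (slab_two_hyperplane Aa full snc pinc) => x; rewrite -LE; exact: slab.
Qed.

(* Constraints whose hyperplane misses the lattice are perturbed; L and the result
   then have the same integer points. *)
Lemma thick_enlargement x0 : lattice_free L -> L x0 ->
  ~ (exists a b1 b2, split_within (aff L) a b1 b2 /\
       forall x, L x -> between b1 (dot a x) b2) ->
  has_enlargement L.
Proof.
move=> Lf Lx0 thickL.
have [j0 [Ij0 ij0]] : exists j, I j /\ i0 != j.
  apply: contrapT => nj; apply: thickL; rewrite {2}LE.
  apply: (one_dim_slab LC Ii0 _ full snc); last by rewrite -LE.
    by move=> i Ii; apply: contrapT => /eqP h; apply: nj; exists i; rewrite eq_sym.
  by exists x0; rewrite -LE.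
have [N [N0 [LN _]]] := polytope_coord_bound [::] z0 cc Lr.
have Lbox x : L x -> sat (box z0 I cc N) x.
  by move=> Lx; apply/sat_box => i _; apply: ltW; exact: LN.
have [s' [ss' s's]] := seq_rel_choice (fun c cs => perturb_constr LC N0 Ii0 Ij0 ij0 (snc cs)).
have s'nc c : c \in s' -> nonconst (aff L) (ipt c.1) by move=> /s's [d _ []].
have satS x : sat (box z0 I cc N ++ s') x <-> sat (box z0 I cc N) x /\ sat s' x.
  split=> [h|[h1 h2] c]; last by rewrite mem_cat => /orP[/h1|/h2].
  by split=> c cs; apply: h; rewrite mem_cat cs ?orbT.
have Lsat x c : L x -> c \in s -> ival c x <= ibound R c.
  by rewrite LE => -[_]; exact.
have LS x : L x -> sat (box z0 I cc N ++ s') x.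
  move=> Lx; apply/satS; split; first exact: Lbox.
  by move=> c' /s's [c cs [_ _ h _]]; apply: h; [exact: Lbox|exact: Lsat].
set L' := hpoly (aff L) (box z0 I cc N ++ s').
have L'L z : is_int_pt z -> L' z -> L z.
  move=> zi [Az /satS [zb zs']]; rewrite LE; split=> // c cs.
  have [c' c's' [_ _ _ /(_ z Az zb zi) [h _]]] := ss' c cs.
  by apply: h; exact: zs'.
have LL' z : L z -> L' z by move=> Lz; split; [exact: sub_aff|exact: LS].
have full' x : aff L x -> aff L' x by exact: aff_sub.
have S'nc c : c \in box z0 I cc N ++ s' -> nonconst (aff L) (ipt c.1).
  by rewrite mem_cat => /orP[/(box_nonconst LC)|/s'nc].
have same z : is_int_pt z -> L z <-> L' z by move=> zi; split; [exact: LL'|exact: L'L].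
have tight c c' : c \in s -> c' \in s' ->
  (forall x, aff L x -> sat (box z0 I cc N) x -> is_int_pt x ->
     (ival c' x <= ibound R c' -> ival c x <= ibound R c) /\
     (ival c x <= ibound R c -> ival c' x = ibound R c' <-> ival c x = ibound R c)) ->
  forall z, L z -> is_int_pt z -> ival c' z = ibound R c' <-> ival c z = ibound R c.
  move=> cs c's' h z Lz zi; apply: (proj2 (h z (sub_aff Lz) (Lbox z Lz) zi)).
  exact: Lsat.
apply: (enlargement_sound LC Ii0 N0 LS s'nc).
- by move=> c' /s's [c _ []].
(* A half-open slab containing [L'] gives a split containing [L]. *)
- move=> a b1 b2 sw H; apply: thickL; exists a, b1, b2; split=> // x Lx.
  by have [] := H x (LL' x Lx).
- move=> z zi L'z; have Lz := L'L z zi L'z.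
  have [c cs zc] : exists2 c, c \in s & ival c z = ibound R c.
    apply: contrapT => n; apply: (Lf z zi); rewrite LE.
    apply: (strict_relint Aa full); first exact: sub_aff.
    move=> c cs; rewrite lt_neqAle Lsat // andbT; apply/eqP => h; apply: n.
    by exists c.
  have [c' c's' [_ _ _ h]] := ss' c cs; exists c' => //.
  by apply/(tight c c' cs c's' h z Lz zi).
have fullL x : aff L x -> aff L x by [].
split.
  apply: (two_hyperplane_transfer (A := aff L) erefl LE Aa full' S'nc).
    by move=> z zi; split=> h; apply/(same z zi).
  move=> c g cs L'g gi gc; have Lg := L'L g gi L'g.
  have [c' c's' [_ _ _ h]] := ss' c cs.
  exists c'; first by rewrite mem_cat c's' orbT.
  by move=> z L'z zi zc; apply/(tight c c' cs c's' h z (L'L z zi L'z) zi).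
apply: (two_hyperplane_transfer (A := aff L) LE erefl Aa fullL snc same).
move=> c' g; rewrite mem_cat => /orP[/mem_box [i Ii c'E]|c's'] Lg gi gc'.
  (* Inequalities of the box are never tight on [L], by the strict bound on coordinates. *)
  exfalso; have := LN g i Lg; rewrite ltr_norml => /andP[h1 h2].
  have abs (f z n : R) : - n < f - z -> f - z < n -> f = z + n \/ - f = n - z -> False.
    by move=> k1 k2 [k3|k3]; [rewrite k3 addrAC subrr add0r ltxx in k2|rewrite -[f]opprK k3 opprB addrAC subrr add0r ltxx in k1].
  apply: (abs _ _ _ h1 h2); case: c'E gc' => ->; rewrite /ival /ibound /=.
    by rewrite rmorphD; left.
  by rewrite idotN rmorphB; right.
have [c cs [_ _ _ h]] := s's c' c's'; exists c => // z Lz zi zc'.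
by apply/(tight c c' cs c's' h z Lz zi).
Qed.

End Cases.

End Enlargement.

Theorem theorem4 (R : realType) (m : nat) (L : pset R m) :
  rat_polytope L ->
  lattice_free L ->
  (exists x y, aff L x /\ aff L y /\ x <> y) ->
  (exists z, aff L z /\ is_int_pt z) ->
  exists L' : pset R m,
    rat_polytope L' /\
    (forall x, L x -> L' x) /\
    (forall x, L' x -> aff L x) /\
    lattice_free L' /\
    (two_hyperplane_property L <-> two_hyperplane_property L') /\
    (forall F, facet L' F ->
       (exists z, aff F z /\ is_int_pt z) /\
       (exists a b1 b2, facet_split (aff L) L' F a b1 b2) /\
       (forall a b1 b2, facet_split (aff L) L' F a b1 b2 ->
          split_intersecting L' a b1 b2)).
Proof.
move=> Lr Lf [x1 [y1 [Ax1 [Ay1 xy1]]]] [z [Az0 [z0 zE]]].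
rewrite {z}zE in Az0.
have [I [e [cc LC]]] := lattice_coords_exists Lr Az0.
have Aa := lc_affine LC.
have LA x : L x -> aff L x by exact: sub_aff.
have [x0 Lx0] : exists x, L x.
  case: Az0 => n [p [w [Lp [w1 _]]]]; case: n p w Lp w1 => [|n] p w Lp w1.
    by move: w1; rewrite big_ord0 => /eqP; rewrite eq_sym oner_eq0.
  by exists (p ord0).
have [i0 Ii0] : exists i, I i.
  apply: contrapT => nI; apply: xy1; rewrite (lc_expand LC x1) (lc_expand LC y1).
  have nI' i : ~~ I i by apply/negP => h; apply: nI; exists i.
  by apply: eq_bigr => i _; rewrite !((proj1 (lc_mem LC _))).
have [s0 Ls0] := rat_polytope_hrep Lr.
have [s [Ls snc]] := hpoly_of_polytope LC Ls0 LA (ex_intro _ x0 Lx0).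
have LE : L = hpoly (aff L) s by apply/funext => x; apply/propext; exact: Ls.
have full x : aff L x -> aff (hpoly (aff L) s) x by rewrite -LE.
have [[a [b1 [b2 [sw Lslab]]]]|thickL] := pselect (exists a b1 b2,
    split_within (aff L) a b1 b2 /\ forall x, L x -> between b1 (dot a x) b2).
  exact: (slab_enlargement Lr LC Ii0 LE full snc sw Lslab).
exact: (thick_enlargement Lr LC Ii0 LE full snc Lf Lx0 thickL).
Qed.
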